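(* Let $R=(r_{ij})$ be a real symmetric $n\times n$ matrix with zero diagonal and $\rho(|R|)<1$, with graph $G$, GaBP messages $\alpha$, and belief-propagation estimate $Z^{\mathrm{bp}}$ (defined in the context). For each directed edge $(ij)$ of $G$ set $r'_{ij}=\frac{r_{ij}}{1-\alpha_{i\setminus j}}$. Then $$\det(I-R)^{-1}=Z^{\mathrm{bp}}\times\prod_{\gamma}\Big(1-\prod_{(ij)}(r'_{ij})^{n_{ij}(\gamma)}\Big)^{-1},$$ where the outer product is over all (nonempty) backtrackless orbits $\gamma$ of $G$.
   Context: $|R|=(|r_{ij}|)$ is the entrywise absolute value and $\rho$ the spectral radius. $G$ is the graph on $V=\{1,\dots,n\}$ with undirected edge $\{i,j\}$ whenever $r_{ij}\neq0$; $\partial i$ is the set of neighbours of $i$; each edge gives directed edges $(ij),(ji)$. A walk is a sequence of vertices $(w_0,\dots,w_L)$ with $\{w_t,w_{t+1}\}\in G$; steps are $(w_tw_{t+1})$; closed means $L\ge1$, $w_0=w_L$; a closed walk is primitive if it is not an $m$-fold concatenation ($m\ge2$) of a shorter closed walk. An orbit is an equivalence class of closed primitive walks under cyclic shifts; $n_{ij}(\gamma)$ is the number of occurrences of step $(ij)$ in orbit $\gamma$. An orbit is regarded as a cyclic sequence of steps; a backtracking pair is a pair of cyclically consecutive steps $(ij)(ji)$; an orbit is backtrackless if it has no backtracking pair. GaBP messages: $\alpha_{ij}=\lim_t\alpha^{(t)}_{ij}$ with $\alpha^{(0)}_{ij}=0$, $\alpha^{(t+1)}_{ij}=r_{ij}^2(1-\sum_{k\in\partial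 i\setminus j}\alpha^{(t)}_{ki})^{-1}$ (convergent when $\rho(|R|)<1$, with $1-\alpha_{i\setminus j}>0$). $\alpha_{i\setminus j}=\sum_{k\in\partial i\setminus j}\alpha_{ki}$. $Z_i^{\mathrm{bp}}=(1-\sum_{k\in\partial i}\alpha_{ki})^{-1}$, $Z_{ij}^{\mathrm{bp}}=\det\begin{pmatrix}1-\alpha_{i\setminus j} & -r_{ij}\\ -r_{ij} & 1-\alpha_{j\setminus i}\end{pmatrix}^{-1}$, $Z^{\mathrm{bp}}=\prod_{i\in V}Z_i^{\mathrm{bp}}\prod_{\{i,j\}\in G}\frac{Z_{ij}^{\mathrm{bp}}}{Z_i^{\mathrm{bp}}Z_j^{\mathrm{bp}}}$. *)

(* Defs.v *)
From HB Require Import structures.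
From mathcomp Require Import all_boot all_order all_algebra.
From mathcomp Require Import all_classical all_reals all_analysis.
From mathcomp.real_closed Require Import complex.
Set Implicit Arguments. Unset Strict Implicit. Unset Printing Implicit Defensive.
Import Order.TTheory GRing.Theory Num.Theory numFieldNormedType.Exports.
Local Open Scope ring_scope.

Section GaBP.
Variables (R : realType) (n : nat).
Implicit Types (A M : 'M[R]_n) (i j k : 'I_n).

Definition absmx M : 'M[R]_n := \matrix_(i, j) `|M i j|.

Definition eigenvalues M : set R[i] :=
  [set l | root (char_poly (map_mx (real_complex R) M)) l].

Definition spectral_radius M : R := sup [set ComplexField.Normc.normc l | l in eigenvalues M].

Definition adj M i j : bool := M i j != 0.
Definition nbrs M i : {set 'I_n} := [set k | adj M i k].

Fixpoint gabp_iter M (t : nat) : 'I_n -> 'I_n -> R :=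
  match t with
  | 0 => fun _ _ => 0
  | t'.+1 => fun i j =>
      M i j ^+ 2 * (1 - \sum_(k in nbrs M i :\ j) gabp_iter M t' k i)^-1
  end.

Definition alpha M i j : R := limn (fun t => gabp_iter M t i j).

Definition alpha_excl M i j : R := \sum_(k in nbrs M i :\ j) alpha M k i.

Definition Zbp_node M i : R := (1 - \sum_(k in nbrs M i) alpha M k i)^-1.

Definition Zbp_edge M i j : R :=
  (\det (\matrix_(a < 2, b < 2)
           if a == b then (if a == 0 then 1 - alpha_excl M i j
                           else 1 - alpha_excl M j i)
           else - M i j))^-1.

(* Z^bp = prod_i Z_i * prod_{ {i,j} in G } Z_ij / (Z_i Z_j);
   undirected edges {i,j} are enumerated once as i < j *)
Definition Zbp M : R :=
  (\prod_i Zbp_node M i) *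
  \prod_(i : 'I_n) \prod_(j : 'I_n | (i < j)%N && adj M i j)
     (Zbp_edge M i j / (Zbp_node M i * Zbp_node M j)).

Definition rprime M i j : R := M i j / (1 - alpha_excl M i j).

(* A closed walk (w_0,...,w_L) with w_L = w_0 is represented by the sequence
   s = [:: w_0; ...; w_(L-1)]; its (cyclic) list of steps is: *)
Definition steps (s : seq 'I_n) : seq ('I_n * 'I_n) := zip s (rot 1 s).

Definition closed_walk M (s : seq 'I_n) : bool :=
  (0 < size s)%N && all (fun e => adj M e.1 e.2) (steps s).

Definition primitive (s : seq 'I_n) : Prop :=
  ~ exists m (u : seq 'I_n), [/\ (2 <= m)%N, (0 < size u)%N & s = flatten (nseq m u)].

Definition backtrackless (s : seq 'I_n) : bool :=
  let st := steps s in
  all (fun p : ('I_n * 'I_n) * ('I_n * 'I_n) =>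
         ~~ ((p.2.1 == p.1.2) && (p.2.2 == p.1.1))) (zip st (rot 1 st)).

Definition nstep (s : seq 'I_n) i j : nat := count (pred1 (i, j)) (steps s).

Definition orbit_of (L : nat) (t : L.-tuple 'I_n) : {set L.-tuple 'I_n} :=
  [set u : L.-tuple 'I_n | [exists k : 'I_L.+1, val u == rot k (val t)]].

Definition bl_orbits M (L : nat) : {set {set L.-tuple 'I_n}} :=
  (@orbit_of L) @: [set t : L.-tuple 'I_n |
                 [&& closed_walk M t, `[< primitive t >] & backtrackless t]].

Definition orbit_weight M (L : nat) (g : {set L.-tuple 'I_n}) : R :=
  if [pick t in g] is Some t then
    \prod_i \prod_(j | adj M i j) rprime M i j ^+ nstep t i j
  else 1.

Definition orbit_partial_prod M (N : nat) : R :=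
  \prod_(1 <= L < N.+1) \prod_(g in bl_orbits M L) (1 - orbit_weight M g)^-1.

End GaBP.

(* Main.v *)
(* Let [W] be the non-backtracking edge matrix: [W_(ij),(kl)] is [r'_ij] when
   [k = j] and [l <> i], and 0 otherwise.

   Algebra: with [u = r'] the GaBP fixed-point equations turn the weighted
   Ihara-Bass identity for [det (I - W)] into
   [det (I - W) = Zbp * det (I - M)].

   Combinatorics: [tr W^k] sums the weights of the backtrackless closed walks
   of length [k], and each of these is a power of a unique primitive walk. So
   [det (I - z W)] and the product of [1 - w(g) z^L] over the orbits of length
   [L <= N] have the same logarithmic derivative modulo [z^(N+1)], and hence
   agree modulo [z^(N+1)].

   Convergence at [z = 1]: [I - |M|] is positive definite, so
   [v = (I - |M|)^-1 1] exists and is positive. It bounds the GaBP messages by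
   [alpha_ij <= |r_ij| v_i / v_j], which makes them converge, and the quantities
   [h_(ji) = (1 - alpha_(j\i)) v_j - |r_ij| v_i >= 1] satisfy
   [h_(ji) = 1 + sum_(k <> i) |r'_kj| h_(kj)]: a positive vector that [|W|]
   strictly contracts, so [tr |W|^k] decays geometrically. *)
Require Import Defs.
From HB Require Import structures.
From mathcomp Require Import all_boot all_order all_algebra.
From mathcomp Require Import all_classical all_reals all_analysis.
From mathcomp.real_closed Require Import complex.
From mathcomp Require Import ring lra.
Import Order.TTheory GRing.Theory Num.Theory numFieldNormedType.Exports.
Local Open Scope classical_set_scope.
Local Open Scope ring_scope.

Set Implicit Arguments.
Unset Strict Implicit.
Unset Printing Implicit Defensive.

(** * Logarithmic derivatives of polynomials modulo a power of X *)

Lemma deriv_prod (R : comNzRingType) (I : finType) (F : I -> {poly R}) :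
  (\prod_i F i)^`() = \sum_i (F i)^`() * \prod_(j | j != i) F j.
Proof.
have gen (r : seq I) : uniq r ->
    (\prod_(i <- r) F i)^`()
      = \sum_(i <- r) (F i)^`() * \prod_(j <- r | j != i) F j.
  elim: r => [|a r IH]; first by rewrite !big_nil derivC.
  move=> /= /andP[ar ur]; rewrite !big_cons derivM IH// eqxx /=.
  congr (_ * _ + _).
    rewrite big_seq [RHS]big_seq_cond; apply: eq_bigl => j.
    by case jr: (j \in r) => //=; symmetry; apply: contraNneq ar => <-.
  rewrite mulr_sumr; apply: eq_big_seq => i ir; rewrite big_cons.
  have -> : a != i by apply: contraNneq ar => ->.
  exact: mulrCA.
exact: gen (index_enum_uniq I).
Qed.

(** Jacobi's formula. [B i] differentiates row [i] only: expansion along that row gives the [i]-th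
    diagonal entry on the right, and summing over [i] is the product rule applied to each term of
    the Leibniz formula. *)
Lemma deriv_det (R : comNzRingType) n (A : 'M[{poly R}]_n) :
  (\det A)^`() = \tr (map_mx (@deriv R) A *m \adj A).
Proof.
pose B i := \matrix_(k, j) (if k == i then (A k j)^`() else A k j).
have detB i : \det (B i) = (map_mx (@deriv R) A *m \adj A) i i.
  rewrite (expand_det_row _ i) mxE; apply: eq_bigr => j _.
  rewrite !mxE eqxx; congr (_ * (_ * \det _)).
  by apply/matrixP => k l; rewrite !mxE eq_sym (negbTE (neq_lift _ _)).
rewrite /mxtrace -(eq_bigr _ (fun i _ => detB i)) /determinant exchange_big /=.
rewrite raddf_sum; apply: eq_bigr => s _ /=.
have dsgn (b : bool) (p : {poly R}) : ((-1) ^+ b * p)^`() = (-1) ^+ b * p^`().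
  by case: b; rewrite ?expr0 ?expr1 ?mul1r// !mulN1r derivN.
rewrite -mulr_sumr dsgn; congr (_ * _).
rewrite deriv_prod; apply: eq_bigr => i _.
rewrite [RHS](bigD1 i)//= mxE eqxx; congr (_ * _).
by apply: eq_bigr => j /negbTE ji; rewrite mxE ji.
Qed.

(* [t] is, up to sign, the logarithmic derivative [X p' / p] modulo [X^(N+1)]. *)
Definition logder (R : comNzRingType) (N : nat) (p t : {poly R}) :=
  exists q, 'X * p^`() + p * t = 'X^(N.+1) * q.

Lemma logderM (R : comNzRingType) N (p q s t : {poly R}) :
  logder N p s -> logder N q t -> logder N (p * q) (s + t).
Proof.
move=> [a pa] [b qb]; exists (q * a + p * b).
by rewrite [RHS]mulrDr !(mulrCA 'X^_) -pa -qb derivM; ring.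
Qed.

Lemma logder_prod (R : comNzRingType) N (I : Type) (r : seq I) (P : pred I)
    (p t : I -> {poly R}) : (forall i, P i -> logder N (p i) (t i)) ->
  logder N (\prod_(i <- r | P i) p i) (\sum_(i <- r | P i) t i).
Proof.
move=> pt; apply: (big_rec2 (logder N)).
  by exists 0; rewrite derivC !mulr0 addr0.
by move=> i x y Pi; apply: logderM; exact: pt.
Qed.

(** With [y = w X^L], the series of [- X p' / p] is [L y / (1 - y)]. Cutting it after [y ^+ N]
    leaves the error [- L y ^+ N.+1], which [X^(N+1)] divides because [L > 0]. *)
Lemma logder_1subcX (R : comNzRingType) N L (w : R) : (0 < L)%N ->
  logder N (1 - w *: 'X^L)
    (\sum_(1 <= m < N.+1) L%:R *: (w *: 'X^L) ^+ m).
Proof.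
move=> L0; set y := w *: 'X^L.
exists (- (L%:R * w ^+ N.+1) *: 'X^(L * N.+1 - N.+1)).
have tele k : (1 - y) * (\sum_(1 <= m < k.+1) L%:R *: y ^+ m)
    = L%:R *: (y - y ^+ k.+1).
  elim: k => [|k IH]; first by rewrite big_geq// mulr0 expr1 subrr scaler0.
  rewrite big_nat_recr//= mulrDr IH -scalerAr -scalerDr; congr (_ *: _).
  rewrite [y ^+ k.+2]exprS. move: (y ^+ k.+1) => z. ring.
rewrite tele derivB derivC sub0r derivZ derivXn.
rewrite -scalerAr -exprD subnKC ?leq_pmull//.
have -> : y ^+ N.+1 = w ^+ N.+1 *: 'X^(L * N.+1) by rewrite exprZn -exprM.
have -> : 'X * - (w *: ('X^(L.-1) *+ L)) = - (L%:R *: y) :> {poly R}.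
  by rewrite mulrN -scalerAr mulrnAr -exprS prednK// scaler_nat scalerMnr.
by rewrite scalerBr addKr scalerA scaleNr.
Qed.

(** By Jacobi's formula the derivative term is [- X tr (V adj A)]. Writing [\det A * \tr S] as
    [tr (adj A A S)] lets the geometric sum [A *m S] telescope without inverting [A]; only a
    multiple of [X^(N+1)] survives. *)
Lemma logder_det (R : comNzRingType) N n (W : 'M[R]_n) :
  logder N (\det (1%:M - 'X *: map_mx polyC W))
    (\sum_(1 <= k < N.+1) \tr (W ^+ k) *: 'X^k).
Proof.
set A := 1%:M - _.
pose V := map_mx polyC W.
have VE k : map_mx polyC (W ^+ k) = V ^+ k by rewrite rmorphXn.
pose S := \sum_(1 <= k < N.+1) 'X^k *: V ^+ k.
have trS : \sum_(1 <= k < N.+1) \tr (W ^+ k) *: 'X^k = \tr S.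
  rewrite /S raddf_sum; apply: eq_bigr => k _ /=.
  by rewrite -VE mxtraceZ trace_map_mx mulrC mul_polyC.
have AS : A *m S = 'X *: V - 'X^(N.+1) *: V ^+ N.+1.
  rewrite /S; elim: (N) => [|k IH].
    by rewrite big_geq// mulmx0 !expr1 subrr.
  rewrite big_nat_recr//= mulmxDr IH /A mulmxBl mul1mx -scalemxAl -scalemxAr.
  rewrite scalerA -exprS mulmxE -exprS addrA subrK //.
have dA : map_mx (@deriv R) A = - V.
  apply/matrixP => i j; rewrite !mxE derivB -polyCMn derivC sub0r.
  by rewrite mulrC mul_polyC derivZ derivX alg_polyC.
rewrite /logder trS deriv_det dA.
exists (- \tr (\adj A *m V ^+ N.+1)).
have -> : \det A * \tr S = \tr (\adj A *m (A *m S)).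
  by rewrite mulmxA mul_adj_mx mul_scalar_mx mxtraceZ.
rewrite AS mulmxBr raddfB /= -!scalemxAr !mxtraceZ mulNmx raddfN /=.
by rewrite mxtrace_mulC; ring.
Qed.

(** The coefficient of [X^(k+1)] gives a Newton-type recurrence for [(k + 1) p_(k+1)] in terms of
    lower coefficients of [p] and those of [s]; [s_0 = 0] removes [p_(k+1)] from its right side. In
    characteristic 0 it determines [p] from [p_0]. *)
Lemma logder_uniq (R : numFieldType) N (p q s t : {poly R}) :
  logder N p s -> logder N q t -> p`_0 = q`_0 -> s`_0 = 0 ->
  (forall k, (k <= N)%N -> s`_k = t`_k) ->
  forall k, (k <= N)%N -> p`_k = q`_k.
Proof.
move=> [a pa] [b qb] pq0 s0 st; elim/ltn_ind => -[//|k] IH kN.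
have E r c u : 'X * r^`() + r * u = 'X^(N.+1) * c -> u`_0 = 0 ->
    r`_k.+1 *+ k.+1 = - \sum_(j < k.+1) r`_j * u`_(k.+1 - j) :> R.
  move=> /(congr1 (fun f : {poly R} => f`_k.+1)).
  rewrite coefD coefXM/= coef_deriv coefM big_ord_recr /= subnn coefXnM ltnS kN.
  by move=> + u0; rewrite u0 mulr0 addr0 => H; apply/eqP; rewrite -addr_eq0 H.
have : p`_k.+1 *+ k.+1 = q`_k.+1 *+ k.+1.
  rewrite (E _ _ _ pa)// (E _ _ _ qb) -?st//; congr (- _).
  apply: eq_bigr => j _; rewrite IH ?st// ?leq_subLR.
  - by rewrite (leq_trans kN)// leq_addl.
  - exact: leq_trans (ltnW (ltn_ord j)) kN.
by move/eqP; rewrite eqrMn2r// => /eqP.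
Qed.

(** * Cyclic sequences and their periods *)

Lemma zip_rot (S T : Type) k (s : seq S) (t : seq T) : size s = size t ->
  zip (rot k s) (rot k t) = rot k (zip s t).
Proof.
move=> st.
have tz : take k (zip s t) = zip (take k s) (take k t).
  by elim: k s t {st} => [|k IH] [|x s] [|y t] //=; rewrite ?IH//; case: take.
have dz : drop k (zip s t) = zip (drop k s) (drop k t).
  by elim: k s t st {tz} => [|k IH] [|x s] [|y t] //= [/IH].
by rewrite /rot zip_cat ?tz ?dz// !size_drop st.
Qed.

Lemma flatten_nseqSr (T : Type) m (s : seq T) :
  flatten (nseq m.+1 s) = flatten (nseq m s) ++ s.
Proof. by rewrite -addn1 nseqD flatten_cat /= cats0. Qed.

Lemma size_flatten_nseq (T : Type) m (s : seq T) :
  size (flatten (nseq m s)) = (m * size s)%N.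
Proof. by rewrite size_flatten /shape map_nseq sumn_nseq mulnC. Qed.

Lemma zip_flatten_nseq (S T : Type) m (s : seq S) (t : seq T) :
  size s = size t ->
  zip (flatten (nseq m s)) (flatten (nseq m t)) = flatten (nseq m (zip s t)).
Proof. by move=> st; elim: m => //= m IH; rewrite zip_cat// IH. Qed.

Lemma rot1_flatten_nseq (T : Type) m (s : seq T) :
  rot 1 (flatten (nseq m s)) = flatten (nseq m (rot 1 s)).
Proof.
case: s => [|x s]; first by elim: m.
rewrite rot1_cons; case: m => // m /=.
rewrite rot1_cons -!cats1 -!catA; congr (_ ++ _).
by elim: m => //= m IH; rewrite -!catA IH.
Qed.

Lemma rot_flatten_nseq (T : Type) m (s : seq T) :
  rot (size s) (flatten (nseq m s)) = flatten (nseq m s).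
Proof.
case: m => [|m]; first by rewrite /rot.
by rewrite [RHS]flatten_nseqSr -rot_size_cat.
Qed.

Section Period.
Variable T : eqType.
Implicit Types s u : seq T.

(* The junk value of [period [::]] is 1. *)
Definition period s : nat := (find (fun d => rot d.+1 s == s) (iota 0 (size s))).+1.

Lemma period_rot s k : period (rot k s) = period s.
Proof.
rewrite /period size_rot; congr _.+1; apply: eq_find => d.
by rewrite rot_rot (inj_eq (@rot_inj k T)).
Qed.

Lemma rot_period s : rot (period s) s = s.
Proof.
case: s => [//|x s]; rewrite /period; set t := x :: s.
have h : has (fun d => rot d.+1 t == t) (iota 0 (size t)).
  apply/hasP; exists (size s); first by rewrite mem_iota /= leqnn.
  by rewrite -[(size s).+1]/(size t) rot_size.
have := nth_find 0%N h; rewrite nth_iota; first by move/eqP.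
by rewrite -[X in (_ < X)%N](size_iota 0) -has_find.
Qed.

Lemma period_min s d : (0 < d <= size s)%N -> rot d s = s -> (period s <= d)%N.
Proof.
case: d => [//|d] /= ds rs; rewrite /period ltnS leqNgt; apply/negP => lt.
by have := before_find 0%N lt; rewrite nth_iota// add0n rs eqxx.
Qed.

Lemma period_le s : (0 < size s)%N -> (period s <= size s)%N.
Proof. by move=> s0; apply: period_min; rewrite ?s0 ?leqnn ?rot_size. Qed.

(** Otherwise the remainder of [d] would be a smaller positive shift fixing [s]. The bound on [d] is
    essential: [rot d s] is [s] for every [d] beyond the length. *)
Lemma dvdn_period s d : (d <= size s)%N -> rot d s = s -> (period s %| d)%N.
Proof.
move=> ds rs; rewrite /dvdn; apply/negPn/negP; rewrite -lt0n => r0.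
set p := period s in r0 *.
have rq q : (q * p <= size s)%N -> rot (q * p) s = s.
  elim: q => [|q IH]; first by rewrite rot0.
  rewrite mulSn => qs; rewrite rotD// IH ?rot_period//.
  by rewrite (leq_trans _ qs)// leq_addl.
have : (p <= d %% p)%N.
  apply: period_min.
    by rewrite r0 (leq_trans (leq_mod _ _)).
  have le : (d %/ p * p <= size s)%N by rewrite (leq_trans (leq_trunc_div _ _)).
  by rewrite -{1}(rq _ le) -rotD addnC -divn_eq.
by rewrite leqNgt ltn_mod.
Qed.

(** Cut [s] as [x ++ y] after [d] letters. Invariance reads [y ++ x = x ++ y], so a nonempty [y]
    again starts with [x] and is fixed by the same rotation. *)
Lemma rot_flatten_take s m d :
  size s = (m * d)%N -> rot d s = s -> s = flatten (nseq m (take d s)).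
Proof.
elim: m s => [|m IH] s; first by move=> /size0nil.
rewrite mulSn => sz rs.
have sx : size (take d s) = d by rewrite size_takel// sz leq_addr.
have sy : size (drop d s) = (m * d)%N by rewrite size_drop sz addKn.
have xy := cat_take_drop d s.
move: rs; rewrite /rot -{3}xy; move: (take d s) (drop d s) sx sy xy => x y sx sy xy yx.
rewrite -xy /=; congr (_ ++ _).
case: m IH sy {sz} => [_ /size0nil//|m] IH sy.
have dy : (d <= size y)%N by rewrite sy mulSn leq_addr.
have yE : y = x ++ drop d y.
  rewrite -{1}(cat_take_drop d y); congr (_ ++ _).
  by have /(congr1 (take d)) := yx; rewrite takel_cat// -sx take_size_cat.
have rx : rot d y = y.
  have : x ++ drop d y ++ x = x ++ y by rewrite catA -yE.
  move/eqP; rewrite eqseq_cat// eqxx => /= /eqP yx'.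
  by rewrite {1}yE -{1}sx rot_size_cat.
have <- : take d y = x by rewrite yE -sx take_size_cat.
exact: IH.
Qed.

(** The period [p] of the repetition divides [size u], so [u] is itself a repetition of its first
    [p] letters. Rotation by [p] then fixes [u], whence [size u <= p]. *)
Lemma period_nseq u m : (0 < m)%N -> (0 < size u)%N -> period u = size u ->
  period (flatten (nseq m u)) = size u.
Proof.
move=> m0 u0 pu; set s := flatten _.
have ss : size s = (m * size u)%N by exact: size_flatten_nseq.
have us : (size u <= size s)%N by rewrite ss leq_pmull.
have pd : (period s %| size u)%N by rewrite dvdn_period// rot_flatten_nseq.
have ts : take (size u) s = u.
  by rewrite /s; case: (m) m0 => // k _; rewrite /= take_size_cat.
have sE : s = flatten (nseq (m * (size u %/ period s)) (take (period s) s)).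
  by apply: rot_flatten_take; rewrite ?rot_period// -mulnA divnK.
have pl : (period s <= size s)%N by rewrite period_le// (leq_trans u0).
have uE : u = flatten (nseq (size u %/ period s) (take (period s) s)).
  rewrite -{1}ts {1}sE; case: (m) m0 => // k _.
  rewrite mulSn nseqD flatten_cat take_size_cat//.
  by rewrite size_flatten_nseq size_takel// divnK.
apply/eqP; rewrite eqn_leq (dvdn_leq u0 pd) /= -{1}pu.
apply: period_min; first by rewrite (dvdn_leq u0 pd) andbT.
have {1}-> : period s = size (take (period s) s) by rewrite size_takel.
have rk w k : u = flatten (nseq k w) -> rot (size w) u = u.
  by move=> ->; exact: rot_flatten_nseq.
exact: rk uE.
Qed.

Lemma period_nseq_le u m : (0 < size u)%N ->
  (period (flatten (nseq m u)) <= period u)%N.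
Proof.
(* For [m = 0] the repetition is empty, and its junk period 1 is at most any period. *)
case: m => [|m] u0; first by rewrite ltnS.
have pu := period_le u0.
have uE : u = flatten (nseq (size u %/ period u) (take (period u) u)).
  by apply: rot_flatten_take; rewrite ?rot_period ?divnK// dvdn_period ?rot_size.
have nn k q v : flatten (nseq k (flatten (nseq q v))) = flatten (nseq (k * q) v) :> seq T.
  by elim: k => //= k ->; rewrite mulSn nseqD flatten_cat.
apply: period_min; first by rewrite size_flatten_nseq (leq_trans pu)// leq_pmull.
have gen w q : u = flatten (nseq q w) ->
    rot (size w) (flatten (nseq m.+1 u)) = flatten (nseq m.+1 u).
  by move=> ->; rewrite nn; exact: rot_flatten_nseq.
by have := gen _ _ uE; rewrite size_takel.
Qed.

End Period.

(** Replaces the quantification over all decompositions by a decidable condition on rotations, by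
    which walks can be sorted and orbits counted. *)
Lemma primitive_period n (s : seq 'I_n) : (0 < size s)%N ->
  primitive s <-> period s = size s.
Proof.
move=> s0; have pd : (period s %| size s)%N by rewrite dvdn_period ?rot_size.
have pl := period_le s0.
split=> [ps|ps [m [u [m2 u0 sE]]]].
  apply/eqP; rewrite eqn_leq pl leqNgt; apply/negP => lt; apply: ps.
  exists (size s %/ period s)%N, (take (period s) s); split.
  - by rewrite ltn_divRL// mul1n.
  - by rewrite size_takel.
  - by apply: rot_flatten_take; rewrite ?rot_period// divnK.
have ss : size s = (m * size u)%N by rewrite sE size_flatten_nseq.
have := @period_min _ s (size u); rewrite ps ss leq_pmull ?(leq_trans _ m2)// u0.
have := rot_flatten_nseq m u; rewrite -sE => rs /(_ isT rs).
by rewrite leqNgt ltn_Pmull.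
Qed.

Lemma steps_rot n k (s : seq 'I_n) : steps (rot k s) = rot k (steps s).
Proof. by rewrite /steps rot_rot zip_rot// size_rot. Qed.

Lemma steps_nseq n m (s : seq 'I_n) :
  steps (flatten (nseq m s)) = flatten (nseq m (steps s)).
Proof. by rewrite /steps rot1_flatten_nseq zip_flatten_nseq// size_rot. Qed.

Lemma size_steps n (s : seq 'I_n) : size (steps s) = size s.
Proof. by rewrite size_zip size_rot minnn. Qed.

Lemma backtrackless_rot n k (s : seq 'I_n) :
  backtrackless (rot k s) = backtrackless s.
Proof.
rewrite /backtrackless steps_rot rot_rot zip_rot ?size_rot//.
by apply: perm_all; rewrite perm_rot.
Qed.

Lemma backtrackless_nseq n m (s : seq 'I_n) : (0 < m)%N ->
  backtrackless (flatten (nseq m s)) = backtrackless s.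
Proof.
move=> m0; rewrite /backtrackless steps_nseq rot1_flatten_nseq.
rewrite zip_flatten_nseq ?size_rot//; set a := (X in all X _).
case: m m0 => // m _ /=; rewrite all_cat.
case e: (all a _) => //=; elim: m => //= m IH; by rewrite all_cat e.
Qed.

(** * Positive definiteness *)

(** [sup] dominates its set only when the set is bounded above; the sum of the moduli of all roots
    of the characteristic polynomial is such a bound. *)
Lemma normc_eigenvalue_le (R : realType) n (A : 'M[R]_n) l :
  eigenvalues A l -> ComplexField.Normc.normc l <= spectral_radius A.
Proof.
move=> Al; apply: ub_le_sup; last by exists l.
have [rs pE] := closed_field_poly_normal (char_poly (map_mx (real_complex R) A)).
exists (\sum_(r <- rs) ComplexField.Normc.normc r) => _ [x Ax <-].
have n0 (z : R[i]) : 0 <= ComplexField.Normc.normc z by case: z => a b; exact: sqrtr_ge0.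
have : x \in rs.
  move: Ax; rewrite /eigenvalues /= pE (monicP (char_poly_monic _)) scale1r.
  by rewrite root_prod_XsubC.
move=> xrs; rewrite (big_rem x)//= lerDl.
by apply: sumr_ge0.
Qed.

(** Spectral theorem over [R[i]]: [A] is unitarily diagonalizable with real eigenvalues
    [sp 0 j < 1], and in the coordinates [y] of [x] the form is the sum of
    [(1 - sp 0 j) |y_j|^2]. *)
Lemma symmetric_posdef (R : realType) n (A : 'M[R]_n) (x : 'rV[R]_n) :
  A^T = A -> spectral_radius A < 1 -> (x *m (1%:M - A) *m x^T) 0 0 <= 0 -> x = 0.
Proof.
move=> As A1; pose c := real_complex R; pose A' := map_mx c A.
have A'real : A' \is a mxOver Num.real.
  by apply/mxOverP => i j; rewrite mxE; apply/complex_realP; exists (A i j).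
have A's : A' \is symmetricmx.
  by apply/is_hermitianmxP; rewrite expr0 scale1r map_mx_id// /A' map_trmx As.
have A'h : A' \is hermsymmx by apply: realsym_hermsym.
have A'n := hermitian_normalmx A'h.
have /orthomx_spectralP := A'n.
have spr := hermitian_spectral_diag_real A'h.
set P := spectralmx _ in spr *; set sp := spectral_diag _ in spr * => A'E.
have Pu : P \is unitarymx := spectral_unitarymx _.
have Punit : P \in unitmx := unitarymx_unit Pu.
have sp1 i : sp 0 i < 1.
  (* Row [i] of the unitary matrix [P] is a left eigenvector; it is nonzero because [P] is
     invertible. *)
  have ei : eigenvalue A' (sp 0 i).
    apply/eigenvalueP; exists (row i P).
      rewrite {1}A'E !mulmxA -row_mul mulmxV// rowE mulmx1 -rowE row_diag_mx.
      by rewrite -scalemxAl -rowE.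
    apply: contraTneq Punit => ri; rewrite -row_free_unit -kermx_eq0.
    apply/negP => /eqP k0.
    have : ((delta_mx 0 i : 'rV_n) <= kermx P)%MS by rewrite sub_kermx -rowE ri.
    rewrite k0 submx0 => /eqP/matrixP/(_ 0 i)/eqP.
    by rewrite !mxE !eqxx oner_eq0.
  have : ComplexField.Normc.normc (sp 0 i) < 1.
    apply: le_lt_trans A1; apply: normc_eigenvalue_le.
    by rewrite /eigenvalues /= -eigenvalue_root_char.
  have /mxOverP/(_ 0 i) := spr.
  case: (sp 0 i) => a b; rewrite complex_real /= => /eqP ->.
  rewrite expr0n addr0 sqrtr_sqr => a1.
  by rewrite ltcE /= eqxx /= (le_lt_trans (ler_norm a)).
pose x' := map_mx c x; pose y := x' *m (P ^t*)%sesqui.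
have PK : (P ^t*)%sesqui *m P = 1%:M by rewrite -invmx_unitary// mulVmx.
have yE : P *m x'^T = (y ^t*)%sesqui.
  rewrite /y trmx_mul map_mxM; congr (_ *m _).
    apply/matrixP => i j; rewrite !mxE; exact/esym/conjCK.
  apply/matrixP => i j; rewrite !mxE; apply/esym/CrealP.
  by apply/complex_realP; exists (x j i).
have E : c ((x *m (1%:M - A) *m x^T) 0 0)
    = \sum_j (1 - sp 0 j) * (y 0 j * (y 0 j)^*).
  have -> : c ((x *m (1%:M - A) *m x^T) 0 0) = (x' *m (1%:M - A') *m x'^T) 0 0.
    have -> : 1%:M - A' = map_mx c (1%:M - A) by rewrite map_mxB map_mx1.
    by rewrite map_trmx -!map_mxM [RHS]mxE.
  have -> : 1%:M - A' = (P ^t*)%sesqui *m (1%:M - diag_mx sp) *m P.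
    by rewrite mulmxBr mulmxBl mulmx1 PK -invmx_unitary// -A'E.
  rewrite !mulmxA -mulmxA yE -/y mulmxBr mulmx1 mxE; apply: eq_bigr => j _.
  by rewrite mul_mx_diag !mxE; ring.
rewrite -lecR -/(c _) E => le0.
have ge0 j : 0 <= (1 - sp 0 j) * (y 0 j * (y 0 j)^*).
  by rewrite mulr_ge0 ?mul_conjC_ge0// subr_ge0 ltW.
have y0 : y = 0.
  have s0 : \sum_j (1 - sp 0 j) * (y 0 j * (y 0 j)^*) = 0.
    by apply/eqP; rewrite eq_le le0 sumr_ge0.
  have := psumr_eq0P (fun j _ => ge0 j) s0 => z.
  apply/matrixP => i j; rewrite ord1 [RHS]mxE; apply/eqP.
  have /eqP := z j isT; rewrite mulf_eq0 mul_conjC_eq0 subr_eq0.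
  by rewrite eq_sym lt_eqF.
have : x' = 0.
  by rewrite -(mulmx1 x') -PK mulmxA -/y y0 mul0mx.
move=> /matrixP x0; apply/matrixP => i j; have := x0 i j; rewrite !mxE.
by move/eqP; rewrite fmorph_eq0 => /eqP.
Qed.

(** Positive definiteness makes [1%:M - A] invertible, which gives a solution [v], and also forces
    the negative part of [v] to vanish. Then [v] is at least 1 by its own equation. *)
Lemma neumann_vector (R : realType) n (A : 'M[R]_n) :
  A^T = A -> spectral_radius A < 1 -> (forall i j, 0 <= A i j) ->
  exists v : 'I_n -> R, (forall i, 0 < v i) /\
    (forall i, v i = 1 + \sum_j A i j * v j).
Proof.
move=> As A1 A0.
have Bu : 1%:M - A \in unitmx.
  rewrite -row_free_unit -kermx_eq0; apply/eqP/row_matrixP => i.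
  rewrite row0; apply: (symmetric_posdef As A1).
  by rewrite -row_mul mulmx_ker row0 mul0mx mxE.
have [v vB] : exists v : 'rV[R]_n, v *m (1%:M - A) = const_mx 1.
  by exists (const_mx 1 *m invmx (1%:M - A)); rewrite mulmxKV.
have vE j : v 0 j = 1 + \sum_i A j i * v 0 i.
  have -> : \sum_i A j i * v 0 i = (v *m A) 0 j.
    by rewrite mxE; apply: eq_bigr => i _; rewrite mulrC -[in LHS]As mxE.
  have e : (v - v *m A) 0 j = 1.
    by rewrite -[v in v - _]mulmx1 -mulmxBr vB mxE.
  have subE (a b : 'rV[R]_n) : (a - b) 0 j = a 0 j - b 0 j by rewrite !mxE.
  by rewrite -e subE subrK.
(* The negative part [m] of [v] satisfies [m (I - A) m^T <= 0]. *)
pose m : 'rV[R]_n := \row_j Num.max (- v 0 j) 0.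
have m0 : m = 0.
  apply: (symmetric_posdef As A1).
  have -> : m *m (1%:M - A) *m m^T = (v + m) *m (1%:M - A) *m m^T - const_mx 1 *m m^T.
    by rewrite mulmxDl vB mulmxDl addrAC subrr add0r.
  (* [v + m] is the positive part of [v], so its entrywise product with [m] vanishes; the two
     remaining terms enter with a minus sign and are products of nonnegative quantities. *)
  rewrite mulmxBr mulmx1 mulmxBl !mxE -sumrB -sumrB.
  apply: sumr_le0 => j _; rewrite !mxE mul1r.
  set a := \sum_(_ | _) _.
  have a0 : 0 <= a.
    apply: sumr_ge0 => i _; rewrite !mxE mulr_ge0//.
    by case: (leP (- v 0 i) 0); lra.
  have : 0 <= a * Num.max (- v 0 j) 0 by rewrite mulr_ge0// le_max lexx orbT.
  by case: (leP (- v 0 j) 0) => h; nra.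
have v0 i : 0 <= v 0 i.
  have /matrixP/(_ 0 i) := m0; rewrite !mxE.
  by case: (leP (- v 0 i) 0) => h; lra.
exists (v 0); split => // i; rewrite vE.
by rewrite ltr_pwDl// sumr_ge0// => j _; rewrite mulr_ge0.
Qed.

(** * Traces and backtrackless closed walks *)

Lemma big_tupleS (V : nmodType) (T : finType) k (G : seq T -> V) :
  \sum_(s : k.+1.-tuple T) G s = \sum_x \sum_(s : k.-tuple T) G (x :: s).
Proof.
rewrite pair_big /= (reindex (fun p : T * k.-tuple T => [tuple of p.1 :: p.2])) //=.
exists (fun t : k.+1.-tuple T => (thead t, [tuple of behead t])) => [[x s] _|t _] /=.
  by congr (_, _); apply/val_inj.
by case/tupleP: t => x s; apply/val_inj.
Qed.

Section KernelMatrix.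
Variables (R : comNzRingType) (T : finType) (F : T -> T -> R).

Definition kernel_mx : 'M[R]_#|T| := \matrix_(a, b) F (enum_val a) (enum_val b).

Lemma kernel_mx_exp k x y :
  (kernel_mx ^+ k.+1) (enum_rank x) (enum_rank y)
    = \sum_(s : k.-tuple T) \prod_(p <- zip (x :: s) (rcons s y)) F p.1 p.2.
Proof.
elim: k x => [|k IH] x.
  rewrite expr1 mxE !enum_rankK (bigD1 [tuple])//= big_seq1 big1 ?addr0// => t.
  by case/eqP; exact: tuple0.
rewrite exprS mxE (reindex enum_rank) /=; last first.
  by apply: onW_bij; exact: enum_rank_bij.
rewrite (big_tupleS _ (fun s => \prod_(p <- zip (x :: s) (rcons s y)) F p.1 p.2)).
apply: eq_bigr => z _; rewrite IH mxE !enum_rankK mulr_sumr.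
by apply: eq_bigr => s _ /=; rewrite big_cons.
Qed.

Lemma trace_kernel_mx_exp k : (0 < k)%N ->
  \tr (kernel_mx ^+ k)
    = \sum_(s : k.-tuple T) \prod_(p <- zip s (rot 1 s)) F p.1 p.2.
Proof.
case: k => // k _; rewrite /mxtrace (reindex enum_rank) /=; last first.
  by apply: onW_bij; exact: enum_rank_bij.
rewrite (big_tupleS _ (fun s => \prod_(p <- zip s (rot 1 s)) F p.1 p.2)).
by apply: eq_bigr => x _; rewrite kernel_mx_exp; apply: eq_bigr => s _; rewrite rot1_cons.
Qed.

End KernelMatrix.

Lemma prod_if_all (R : comNzRingType) (I : Type) (r : seq I) (b : pred I) (f : I -> R) :
  \prod_(i <- r) (if b i then f i else 0) = if all b r then \prod_(i <- r) f i else 0.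
Proof.
elim: r => [|x r IH]; first by rewrite !big_nil.
by rewrite !big_cons IH /=; case: (b x); case: all; rewrite /= ?mulr0 ?mul0r.
Qed.

Lemma all_zip_eq (S S' T : eqType) (f : S -> T) (g : S' -> T) s r : size r = size s ->
  all (fun p => g p.2 == f p.1) (zip s r) = (map g r == map f s).
Proof.
by elim: s r => [|x s IH] [|y r] //= [/IH ->]; rewrite eqseq_cons.
Qed.

Section NonBacktracking.
Variables (R : comNzRingType) (n : nat) (u : 'I_n * 'I_n -> R).

Definition nbt_kernel (e f : 'I_n * 'I_n) : R :=
  if (f.1 == e.2) && (f.2 != e.1) then u e else 0.

Definition walk_weight (s : seq 'I_n) : R := \prod_(e <- steps s) u e.

(** A nonzero product forces each edge to end where the next one starts. Then [s] is the list of
    [steps] of its own starting points, and what remains of the kernel condition is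
    [backtrackless]. *)
Lemma prod_nbt_kernel (s : seq ('I_n * 'I_n)) :
  \prod_(p <- zip s (rot 1 s)) nbt_kernel p.1 p.2
    = if (rot 1 (unzip1 s) == unzip2 s) && backtrackless (unzip1 s)
      then \prod_(e <- s) u e else 0.
Proof.
rewrite /nbt_kernel.
rewrite (prod_if_all _ (fun p => (p.2.1 == p.1.2) && (p.2.2 != p.1.1)) (fun p => u p.1)).
have -> : \prod_(p <- zip s (rot 1 s)) u p.1 = \prod_(e <- s) u e.
  by rewrite -(big_map fst predT u) -/(unzip1 _) unzip1_zip// size_rot.
congr (if _ then _ else _).
rewrite -map_rot -(all_zip_eq snd fst) ?size_rot//.
rewrite (@eq_all _ _ (predI (fun p => p.2.1 == p.1.2)
  (fun p => ~~ ((p.2.1 == p.1.2) && (p.2.2 == p.1.1))))); last first.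
  by move=> p /=; case: (p.2.1 == p.1.2).
rewrite all_predI.
case: (boolP (all _ _)) => //=; rewrite (all_zip_eq snd fst) ?size_rot// => /eqP E.
rewrite /backtrackless (_ : steps (unzip1 s) = s)//.
by rewrite /steps -map_rot E zip_unzip.
Qed.

Lemma size_steps_tuple k (t : k.-tuple 'I_n) : size (steps t) == k.
Proof. by rewrite size_steps size_tuple. Qed.

(** Chaining cyclic edge lists correspond to vertex tuples through [steps], with inverse [map fst].
    All vertex tuples are summed; for [rprime] those leaving the graph have weight 0. *)
Lemma trace_nbt k : (0 < k)%N ->
  \tr (kernel_mx nbt_kernel ^+ k)
    = \sum_(t : k.-tuple 'I_n | backtrackless t) walk_weight t.
Proof.
move=> k0; rewrite trace_kernel_mx_exp//.
under eq_bigr => s _ do rewrite prod_nbt_kernel.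
rewrite -big_mkcond /=.
have u1 (s : seq 'I_n) : unzip1 (steps s) = s by rewrite unzip1_zip// size_rot.
have u2 (s : seq 'I_n) : unzip2 (steps s) = rot 1 s by rewrite unzip2_zip// size_rot.
rewrite (reindex_onto (fun t : k.-tuple 'I_n => Tuple (size_steps_tuple t))
                      (fun s => [tuple of map fst s])) /=; last first.
  move=> s /andP[/eqP E _]; apply/val_inj => /=.
  by rewrite /steps E zip_unzip.
apply: eq_bigl => t; rewrite u1 u2 eqxx /=.
by rewrite andb_idr// => _; apply/eqP/val_inj; exact: u1.
Qed.

Lemma walk_weight_rot k s : walk_weight (rot k s) = walk_weight s.
Proof. by rewrite /walk_weight steps_rot; apply: perm_big; rewrite perm_rot. Qed.

Lemma walk_weight_nseq m s : walk_weight (flatten (nseq m s)) = walk_weight s ^+ m.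
Proof.
rewrite /walk_weight steps_nseq; elim: m => [|m IH] /=; first by rewrite big_nil.
by rewrite big_cat IH exprS.
Qed.

(** Sorts the sequences of length [k] by their period [L], a divisor of [k]. Those of period [L] are
    exactly the [k / L]-fold repetitions of sequences of length and period [L], recovered by
    [take L]. *)
Lemma sum_walk_weight_primitive N k : (0 < k <= N)%N ->
  \sum_(t : k.-tuple 'I_n | backtrackless t) walk_weight t
    = \sum_(1 <= L < N.+1 | (L %| k)%N)
        \sum_(t : L.-tuple 'I_n | (period t == L) && backtrackless t)
          walk_weight t ^+ (k %/ L).
Proof.
move=> /andP[k0 kN].
transitivity (\sum_(t : k.-tuple 'I_n | backtrackless t) \sum_(1 <= L < N.+1 | (L %| k)%N)
   if period t == L then walk_weight t else 0).
  apply: eq_bigr => t _; rewrite big_mkcond (bigD1_seq (period t)) ?iota_uniq//=.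
    rewrite eqxx dvdn_period ?size_tuple ?rot_oversize ?size_tuple//.
    rewrite big1 ?addr0// => L.
    by rewrite eq_sym => /negbTE ->; rewrite if_same.
  have := @period_le _ t; rewrite size_tuple mem_index_iota => /(_ k0) pk.
  by rewrite ltnS (leq_trans pk).
rewrite exchange_big /= big_seq_cond [RHS]big_seq_cond; apply: eq_bigr => L.
rewrite mem_index_iota => /andP[/andP[L0 _] /dvdnP[m km]].
move: k0 {kN}; subst k; rewrite muln_gt0 => /andP[m0 _].
rewrite mulnK// -big_mkcondr /=.
have hP (t : L.-tuple 'I_n) : size (flatten (nseq m (val t))) == (m * L)%N.
  by rewrite size_flatten_nseq size_tuple.
have gP (t : (m * L).-tuple 'I_n) : size (take L t) == L.
  by rewrite size_takel// size_tuple leq_pmull.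
rewrite (reindex_onto (fun t => Tuple (hP t)) (fun t => Tuple (gP t))) /=; last first.
  move=> t /andP[_ /eqP pt]; apply/val_inj => /=.
  have rt : rot L t = t by have := rot_period (val t); rewrite pt.
  by rewrite -rot_flatten_take ?size_tuple.
apply: eq_big => [t|t _]; last exact: walk_weight_nseq.
rewrite backtrackless_nseq//.
have -> : Tuple (gP (Tuple (hP t))) == t.
  apply/eqP/val_inj => /=; case: (m) m0 => // q _.
  by apply: take_size_cat; exact: size_tuple.
rewrite andbT andbC; congr (_ && _).
have t0 : (0 < size t)%N by rewrite size_tuple.
apply/eqP/eqP => pL; last by rewrite period_nseq// size_tuple.
have := period_nseq_le m t0; rewrite pL => Lp.
apply/eqP; rewrite eqn_leq Lp andbT.
by have := period_le t0; rewrite size_tuple.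
Qed.

Variables (L : nat).
Implicit Types (t : L.-tuple 'I_n) (g : {set L.-tuple 'I_n}).

Lemma orbit_ofP t t' :
  reflect (exists2 k, (k <= L)%N & val t' = rot k (val t)) (t' \in orbit_of t).
Proof.
rewrite inE; apply: (iffP existsP) => [[k /eqP tk]|[k kL tk]].
  by exists k => //; rewrite -ltnS.
by exists (Ordinal (kL : (k < L.+1)%N)); apply/eqP.
Qed.

Lemma orbit_of_refl t : t \in orbit_of t.
Proof. by apply/orbit_ofP; exists 0%N; rewrite ?rot0. Qed.

Lemma orbit_of_eq t t' : t' \in orbit_of t -> orbit_of t' = orbit_of t.
Proof.
have sub (a b : L.-tuple 'I_n) : b \in orbit_of a -> orbit_of b \subset orbit_of a.
  move=> /orbit_ofP[k kL bk]; apply/fintype.subsetP => c /orbit_ofP[j jL cj].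
  apply/orbit_ofP; rewrite cj bk.
  rewrite rot_add_mod ?size_tuple//.
  case: (leqP (j + k) L) => kj; first by exists (j + k)%N.
  by exists (j + k - L)%N; rewrite // leq_subLR leq_add.
have sym (a b : L.-tuple 'I_n) : b \in orbit_of a -> a \in orbit_of b.
  move=> /orbit_ofP[k kL bk]; apply/orbit_ofP; exists (L - k)%N.
    exact: leq_subr.
  by have := rotK k (val a); rewrite /rotr size_rot size_tuple -bk.
by move=> tt; apply/eqP; rewrite finset.eqEsubset !sub// sym.
Qed.

(** The [L] rotations are distinct, since two equal ones would make the difference of their shifts a
    positive shift below [L] fixing [t]. *)
Lemma card_orbit_of t : (0 < L)%N -> period t = L -> #|orbit_of t| = L.
Proof.
move=> L0 pt.
have rP (k : 'I_L) : size (rot k t) == L by rewrite size_rot size_tuple.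
have -> : orbit_of t = [set Tuple (rP k) | k : 'I_L].
  apply/finset.setP => t'; apply/orbit_ofP/imsetP => [[k kL tk]|[k _ ->]]; last first.
    by exists k => //; exact: ltnW.
  move: kL; rewrite leq_eqVlt => /orP[/eqP kL|kL]; last first.
    by exists (Ordinal kL) => //; apply/val_inj.
  (* [orbit_of] also admits the shift [L], which is the identity and is represented here by the
     shift 0. *)
  exists (Ordinal L0) => //; apply/val_inj => /=.
  by rewrite rot0 tk kL rot_oversize// size_tuple.
rewrite card_imset ?card_ord// => i j /(congr1 val) /=.
wlog ij : i j / (i <= j)%N.
  by move=> H; case: (leqP i j) => [|/ltnW] h e; [|apply/esym]; apply: H.
rewrite -{1}(subnKC ij) rotD ?subnKC ?size_tuple// ?(ltnW (ltn_ord _))// => /rot_inj/esym rd.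
apply/val_inj/eqP; rewrite eqn_leq ij /= -subn_eq0; apply: contraT; rewrite -lt0n => d0.
have := @period_min _ t (j - i); rewrite d0 size_tuple pt leq_subLR.
rewrite (leq_trans (ltnW (ltn_ord j)))// ?leq_addl// => /(_ isT rd).
by rewrite leqNgt (leq_ltn_trans (leq_subr _ _)).
Qed.

Lemma sum_orbit_of (V : zmodType) (A : {set L.-tuple 'I_n}) (f : L.-tuple 'I_n -> V)
    (fg : {set L.-tuple 'I_n} -> V) : (0 < L)%N ->
  (forall t, t \in A -> period t = L) ->
  (forall t t', t \in A -> t' \in orbit_of t -> t' \in A) ->
  (forall t, t \in A -> f t = fg (orbit_of t)) ->
  \sum_(t in A) f t = \sum_(g in (@orbit_of n L) @: A) fg g *+ L.
Proof.
move=> L0 pA oA fA; rewrite (partition_big_imset (@orbit_of n L)) /=.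
apply: eq_bigr => g /imsetP[t tA ->].
have -> : \sum_(i in A | orbit_of i == orbit_of t) f i
    = \sum_(i in orbit_of t) fg (orbit_of t).
  apply: eq_big => [i|i /andP[iA /eqP <-]]; last exact: fA.
  apply/andP/idP => [[_ /eqP <-]|it]; first exact: orbit_of_refl.
  by split; [exact: oA it | rewrite (orbit_of_eq it)].
by rewrite sumr_const card_orbit_of// pA.
Qed.

End NonBacktracking.

(** * GaBP messages *)

Section GaBPBounds.
Variables (R : realType) (n : nat) (M : 'M[R]_n) (v : 'I_n -> R).
Hypothesis Msym : M^T = M.
Hypothesis v_gt0 : forall i, 0 < v i.
Hypothesis vE : forall i, v i = 1 + \sum_j `|M i j| * v j.

Lemma sym_entry i j : M j i = M i j.
Proof. by rewrite -[in RHS]Msym mxE. Qed.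

Definition admissible (x : 'I_n -> 'I_n -> R) :=
  forall i j, 0 <= x i j <= `|M i j| * v i / v j.

(** The upper bounds on the incoming messages other than from [j] sum to the terms [k != j] of the
    equation for [v i]; the constant 1 and the term of [j] are left over. *)
Lemma admissible_excl x i j : admissible x ->
  1 + `|M i j| * v j <= (1 - \sum_(k in nbrs M i :\ j) x k i) * v i.
Proof.
move=> xM.
have : \sum_(k in nbrs M i :\ j) x k i <= \sum_(k | k != j) `|M i k| * v k / v i.
  rewrite big_mkcond [leRHS]big_mkcond; apply: ler_sum => k _.
  rewrite !inE; have /andP[x0 xle] := xM k i.
  case: (k == j) => //=; case: ifP => _; rewrite -sym_entry//.
  by rewrite (le_trans x0).
rewrite -mulr_suml ler_pdivlMr// => le.
have := vE i; rewrite (bigD1 j)//= => vi.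
by rewrite mulrBl mul1r {1}vi; lra.
Qed.

Lemma admissible_node x i : admissible x ->
  1 <= (1 - \sum_(k in nbrs M i) x k i) * v i.
Proof.
move=> xM.
have : \sum_(k in nbrs M i) x k i <= \sum_k `|M i k| * v k / v i.
  rewrite big_mkcond; apply: ler_sum => k _.
  have /andP[x0 xle] := xM k i.
  by case: ifP => _; rewrite -sym_entry// (le_trans x0).
rewrite -mulr_suml ler_pdivlMr// => le.
by rewrite mulrBl mul1r {1}vE; lra.
Qed.

Lemma admissible_excl_gt0 x i j : admissible x ->
  0 < 1 - \sum_(k in nbrs M i :\ j) x k i.
Proof.
move=> xM; have h := @admissible_excl x i j xM; rewrite -(pmulr_lgt0 _ (v_gt0 i)).
by apply: lt_le_trans h; rewrite ltr_pwDl// mulr_ge0// ltW.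
Qed.

(** By [admissible_excl] the denominator of the update is at least [|M i j| v_j / v_i], so dividing
    [M i j ^+ 2] by it reproduces the upper bound. *)
Lemma gabp_iter_admissible t : admissible (gabp_iter M t).
Proof.
elim: t => [|t IH] i j /=.
  by rewrite lexx /= divr_ge0 ?mulr_ge0// ltW.
have d0 := @admissible_excl_gt0 _ i j IH.
have h := @admissible_excl _ i j IH.
apply/andP; split; first by rewrite mulr_ge0 ?sqr_ge0// invr_ge0 ltW.
rewrite ler_pdivrMr// [leRHS]mulrAC ler_pdivlMr//.
rewrite -[M i j ^+ 2]real_normK ?num_real// expr2 -!mulrA ler_wpM2l//.
by rewrite (mulrC (v i)); lra.
Qed.

(** The iteration starts at the lower bound 0, and the update is increasing in the messages as long
    as the denominators stay positive. *)
Lemma gabp_iter_mono i j : nondecreasing_seq (fun t => gabp_iter M t i j).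
Proof.
apply/nondecreasing_seqP => t; elim: t i j => [|t IH] i j.
  by have /andP[] := gabp_iter_admissible 1 i j.
have d1 := @admissible_excl_gt0 _ i j (gabp_iter_admissible t).
have d2 := @admissible_excl_gt0 _ i j (gabp_iter_admissible t.+1).
rewrite [leLHS]/= [leRHS]/=; apply: ler_wpM2l; first exact: sqr_ge0.
by rewrite lef_pV2// lerD2l lerN2; apply: ler_sum => k _; exact: IH.
Qed.

Lemma gabp_iter_is_cvg i j : cvgn (fun t => gabp_iter M t i j).
Proof.
apply: (@nondecreasing_is_cvgn R); first exact: gabp_iter_mono.
exists (`|M i j| * v i / v j) => _ [t _ <-].
by have /andP[] := gabp_iter_admissible t i j.
Qed.

Lemma gabp_iter_cvg i j : (fun t => gabp_iter M t i j) @ \oo --> alpha M i j.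
Proof. exact: gabp_iter_is_cvg. Qed.

Lemma alpha_admissible : admissible (alpha M).
Proof.
move=> i j; apply/andP; split.
  apply: (limr_ge (@gabp_iter_is_cvg i j)); near=> t.
  by have /andP[] := gabp_iter_admissible t i j.
apply: (limr_le (@gabp_iter_is_cvg i j)); near=> t.
by have /andP[] := gabp_iter_admissible t i j.
Unshelve. all: by end_near. Qed.

Lemma alpha_excl_gt0 i j : 0 < 1 - alpha_excl M i j.
Proof. exact: (@admissible_excl_gt0 _ i j alpha_admissible). Qed.

Lemma node_gt0 i : 0 < 1 - \sum_(k in nbrs M i) alpha M k i.
Proof.
rewrite -(pmulr_lgt0 _ (v_gt0 i)).
exact: lt_le_trans (@admissible_node _ i alpha_admissible).
Qed.

Lemma alphaE i j : alpha M i j = M i j ^+ 2 / (1 - alpha_excl M i j).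
Proof.
have h := @gabp_iter_cvg i j; rewrite -(cvg_shiftS) in h.
apply: (cvg_unique _ h) => //=.
apply: cvgM; first exact: cvg_cst.
apply: cvgV; first by rewrite gt_eqF// alpha_excl_gt0.
apply: cvgB; first exact: cvg_cst.
apply: cvg_big => [|k _]; [exact: add_continuous | exact: gabp_iter_cvg].
Qed.

Lemma alpha_rprime i j : alpha M i j = M i j * rprime M i j.
Proof. by rewrite alphaE /rprime expr2 mulrA. Qed.

(** Allows sums of messages over neighbours to be extended to all vertices. *)
Lemma alpha_nadj i j : M i j = 0 -> alpha M i j = 0.
Proof. by move=> m0; rewrite alpha_rprime m0 mul0r. Qed.

Lemma sum_nbrs_alpha i : \sum_(k in nbrs M i) alpha M k i = \sum_k alpha M k i.
Proof.
rewrite big_mkcond; apply: eq_bigr => k _; rewrite inE /adj -sym_entry.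
by case: eqP => //= /alpha_nadj.
Qed.

Lemma alpha_exclE i j : alpha_excl M i j = \sum_(k | k != j) alpha M k i.
Proof.
rewrite /alpha_excl big_mkcond [RHS]big_mkcond; apply: eq_bigr => k _.
rewrite !inE /adj -sym_entry; case: (k == j) => //=.
by case: eqP => //= /alpha_nadj.
Qed.

Lemma alpha_excl_node i j :
  1 - alpha_excl M i j = 1 - \sum_(k in nbrs M i) alpha M k i + alpha M j i.
Proof. by rewrite sum_nbrs_alpha alpha_exclE [X in _ = 1 - X + _](bigD1 j)//=; lra. Qed.

(* The mean messages [h_(i\j)] of Gaussian belief propagation for the linear
   system [(I - |M|) x = 1], read off from its solution [v]. *)
Definition cavity (e : 'I_n * 'I_n) : R :=
  (1 - alpha_excl M e.1 e.2) * v e.1 - `|M e.1 e.2| * v e.2.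

Lemma cavity_ge1 e : 1 <= cavity e.
Proof.
by have := @admissible_excl _ e.1 e.2 alpha_admissible; rewrite /cavity /alpha_excl; lra.
Qed.

(** Each summand equals [|M j k| v_k - alpha M k j * v_j]. Over [k != i] the first parts are
    supplied by the equation for [v j], and the second ones add up to [alpha_excl M j i * v j]. *)
Lemma cavityE j i :
  cavity (j, i) = 1 + \sum_(k | k != i) `|rprime M k j| * cavity (k, j).
Proof.
have E k : `|rprime M k j| * cavity (k, j) = `|M j k| * v k - alpha M k j * v j.
  have d0 := alpha_excl_gt0 k j.
  rewrite /cavity /= alphaE /rprime normrM normfV (gtr0_norm d0) (sym_entry j k).
  rewrite -[M j k ^+ 2]real_normK ?num_real//.
  by field; rewrite gt_eqF.
under eq_bigr => k _ do rewrite E.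
rewrite sumrB -mulr_suml -alpha_exclE /cavity /=.
have := vE j; rewrite (bigD1 i)//= => vj; apply/eqP; rewrite -subr_eq0 mulrBl mul1r {1}vj.
by apply/eqP; ring.
Qed.

End GaBPBounds.

(** * The weighted Ihara-Bass identity *)

(** Both sides are the determinant of the block matrix with rows [(I, A)] and [(-B, I)], factored
    into block triangular matrices in two ways. *)
Lemma det_sylvester (R : comNzRingType) m k (A : 'M[R]_(m, k)) (B : 'M[R]_(k, m)) :
  \det (1%:M + A *m B) = \det (1%:M + B *m A).
Proof.
have E1 : block_mx 1%:M A 0 1%:M *m block_mx (1%:M + A *m B) 0 (- B) 1%:M
    = block_mx 1%:M A (- B) 1%:M :> 'M[R]_(m + k).
  rewrite mulmx_block !mul1mx !mul0mx !mulmx1 !mulmxN !add0r.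
  by rewrite addrK.
have E2 : block_mx 1%:M 0 (- B) 1%:M *m block_mx 1%:M A 0 (1%:M + B *m A)
    = block_mx 1%:M A (- B) 1%:M :> 'M[R]_(m + k).
  rewrite mulmx_block !mul1mx !mul0mx !mulmx1 !mulNmx !addr0.
  by rewrite addrCA addNr addr0.
have := congr1 determinant E1; rewrite -E2 !det_mulmx.
by rewrite det_ublock det_lblock det_lblock det_ublock !det1 !mul1r mulr1.
Qed.

Section KernelAlgebra.
Variables (R : comNzRingType) (T : finType).
Implicit Types F G : T -> T -> R.

Lemma sum_enum_val (V : nmodType) (f : T -> V) :
  \sum_(a < #|T|) f (enum_val a) = \sum_x f x.
Proof.
rewrite (reindex enum_rank) /=; last by apply: onW_bij; exact: enum_rank_bij.
by apply: eq_bigr => x _; rewrite enum_rankK.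
Qed.

Lemma eq_kernel_mx F G : (forall x y, F x y = G x y) -> kernel_mx F = kernel_mx G.
Proof. by move=> FG; apply/matrixP => a b; rewrite !mxE. Qed.

Lemma kernel_mxM F G :
  kernel_mx F *m kernel_mx G = kernel_mx (fun x z => \sum_y F x y * G y z).
Proof.
apply/matrixP => a b; rewrite !mxE -sum_enum_val.
by apply: eq_bigr => c _; rewrite !mxE.
Qed.

Lemma kernel_mxD F G :
  kernel_mx F + kernel_mx G = kernel_mx (fun x y => F x y + G x y).
Proof. by apply/matrixP => a b; rewrite !mxE. Qed.

Lemma kernel_mxN F : - kernel_mx F = kernel_mx (fun x y => - F x y).
Proof. by apply/matrixP => a b; rewrite !mxE. Qed.

Lemma kernel_mx1 : 1%:M = kernel_mx (fun x y : T => (x == y)%:R) :> 'M[R]_#|T|.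
Proof. by apply/matrixP => a b; rewrite !mxE (inj_eq enum_val_inj). Qed.

Lemma det_kernel_diag (d : T -> R) :
  \det (kernel_mx (fun x y => d x *+ (x == y))) = \prod_x d x.
Proof.
have -> : kernel_mx (fun x y => d x *+ (x == y)) = diag_mx (\row_a d (enum_val a)).
  by apply/matrixP => a b; rewrite !mxE (inj_eq enum_val_inj).
rewrite det_diag (reindex enum_rank) /=; last by apply: onW_bij; exact: enum_rank_bij.
by apply: eq_bigr => x _; rewrite mxE enum_rankK.
Qed.

Lemma sum_diag_kernel (d : R) x (g : T -> R) : \sum_y (d *+ (x == y)) * g y = d * g x.
Proof.
rewrite (bigD1 x)//= eqxx mulr1n big1 ?addr0// => y /negbTE yx.
by rewrite eq_sym yx mulr0n mul0r.
Qed.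

End KernelAlgebra.

Definition rev_edge n (e : 'I_n * 'I_n) := (e.2, e.1).

Lemma rev_edgeK n : involutive (@rev_edge n).
Proof. by case. Qed.

Section IharaBass.
Variables (R : fieldType) (n : nat) (u : 'I_n * 'I_n -> R).
Hypothesis u_diag : forall i, u (i, i) = 0.
Local Notation E := ('I_n * 'I_n)%type.
Local Notation rev := (@rev_edge n).

Definition rev_kernel (P : pred E) (e f : E) : R := u e *+ (P e && (f == rev e)).

Lemma sum_rev_kernel P e (g : E -> R) :
  \sum_f rev_kernel P e f * g f = if P e then u e * g (rev e) else 0.
Proof.
rewrite (bigD1 (rev e))//= /rev_kernel eqxx andbT big1 ?addr0; last first.
  by move=> f /negbTE ->; rewrite andbF mul0r.
by case: (P e); rewrite ?mulr1n ?mulr0n ?mul0r.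
Qed.

Local Notation up := (fun e : E => (e.1 < e.2)%N).
Local Notation dn := (fun e : E => (e.2 < e.1)%N).

(** Reversal pairs [e] with [rev e], giving blocks of size 2 with determinant [1 - u e * u (rev e)];
    [u_diag] disposes of its fixed points. In place of a reordering into blocks, the reversal is
    split into an upward part [Nu] and a downward part [Nd]. *)
Lemma det_1D_rev_kernel :
  \det (1%:M + kernel_mx (rev_kernel predT))
    = \prod_(e : E | (e.1 < e.2)%N) (1 - u e * u (rev e)).
Proof.
pose Nu := kernel_mx (rev_kernel up); pose Nd := kernel_mx (rev_kernel dn).
pose U := kernel_mx (fun e f : E => ((e.1 < e.2)%N && (e == f))%:R : R).
pose D := kernel_mx (fun e f : E => ((e.2 < e.1)%N && (e == f))%:R : R).
have NE : kernel_mx (rev_kernel predT) = Nd + Nu.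
  rewrite kernel_mxD; apply: eq_kernel_mx => -[i j] f; rewrite /rev_kernel /=.
  by case: ltngtP => [_|_|/val_inj ->]; rewrite ?u_diag ?mul0rn ?mulr0n ?addr0 ?add0r.
have UNu : U *m Nu = Nu.
  rewrite kernel_mxM; apply: eq_kernel_mx => e f.
  rewrite (bigD1 e)//= eqxx andbT big1 ?addr0; last first.
    by move=> g; rewrite eq_sym => /negbTE ->; rewrite andbF mul0r.
  by rewrite /rev_kernel; case: (e.1 < e.2)%N; rewrite ?mul1r ?mul0r.
have DNd : D *m Nd = Nd.
  rewrite kernel_mxM; apply: eq_kernel_mx => e f.
  rewrite (bigD1 e)//= eqxx andbT big1 ?addr0; last first.
    by move=> g; rewrite eq_sym => /negbTE ->; rewrite andbF mul0r.
  by rewrite /rev_kernel; case: (e.2 < e.1)%N; rewrite ?mul1r ?mul0r.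
have K0 : kernel_mx (fun _ _ : E => 0 : R) = 0.
  by apply/matrixP => a b; rewrite !mxE.
have NdD : Nd *m D = 0.
  rewrite kernel_mxM -K0; apply: eq_kernel_mx => e f; rewrite sum_rev_kernel.
  by rewrite /=; case: ltngtP => //=; rewrite mulr0.
have NuU : Nu *m U = 0.
  rewrite kernel_mxM -K0; apply: eq_kernel_mx => e f; rewrite sum_rev_kernel.
  by rewrite /=; case: ltngtP => //=; rewrite mulr0.
have NdNd : Nd *m Nd = 0 by rewrite -[X in _ *m X]DNd mulmxA NdD mul0mx.
have NuNd : Nu *m Nd *m U = kernel_mx (fun e f : E =>
    (if (e.1 < e.2)%N then u e * u (rev e) else 0) *+ (e == f)).
  rewrite -mulmxA !kernel_mxM; apply: eq_kernel_mx => e f; rewrite sum_rev_kernel.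
  rewrite sum_rev_kernel rev_edgeK /=.
  by case: ltngtP => //=; rewrite ?mul0rn ?mulr0// mulr_natr mulrnAr.
(* Sylvester's identity kills [I + Nd] because [Nd = D Nd] and [Nd D = 0], and
   makes the second factor diagonal. *)
rewrite NE.
have -> : 1%:M + (Nd + Nu) = (1%:M + Nd) *m (1%:M + (1%:M - Nd) *m U *m Nu).
  rewrite -mulmxA UNu mulmxDr mulmx1 mulmxBl mul1mx [X in _ = _ + X]mulmxDl mul1mx.
  by rewrite mulmxBr mulmxA NdNd mul0mx subr0 subrK addrA.
rewrite det_mulmx -{1}DNd det_sylvester NdD addr0 det1 mul1r.
rewrite det_sylvester mulmxA mulmxBr mulmx1 mulmxBl NuU sub0r NuNd.
rewrite kernel_mx1 kernel_mxN kernel_mxD big_mkcond -det_kernel_diag.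
congr (\det _); apply: eq_kernel_mx => e f.
by case: (e == f); case: (e.1 < e.2)%N; rewrite ?mulr0n ?mulr1n ?subr0 ?oppr0 ?addr0.
Qed.

Hypothesis u1 : forall e, 1 - u e * u (rev e) != 0.

(* [I - W = (I + N) - P Q] where [N] is the reversal part of [W] and [P Q]
   factors through the vertices; Sylvester's identity moves the determinant to
   the vertices. *)
Lemma det_1B_nbt_kernel :
  \det (1%:M - kernel_mx (nbt_kernel u))
    = \prod_(e : E | (e.1 < e.2)%N) (1 - u e * u (rev e))
      * \det (\matrix_(i, j)
          ((1 + \sum_k u (i, k) * u (k, i) / (1 - u (i, k) * u (k, i))) *+ (i == j)
           - u (i, j) / (1 - u (i, j) * u (j, i)))).
Proof.
set d := fun e => 1 - u e * u (rev e).
pose N := kernel_mx (rev_kernel predT).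
pose P : 'M[R]_(#|{: E}|, n) := \matrix_(a, j) (u (enum_val a) *+ ((enum_val a).2 == j)).
pose Q : 'M[R]_(n, #|{: E}|) := \matrix_(j, a) ((enum_val a).1 == j)%:R.
pose K := kernel_mx (fun e f : E => (d e)^-1 *+ (e == f)).
have WE : 1%:M - kernel_mx (nbt_kernel u) = 1%:M + N - P *m Q.
  rewrite -addrA; congr (_ + _); apply/matrixP => a b; rewrite !mxE.
  rewrite (bigD1 (enum_val b).1)//= big1 ?addr0; last first.
    by move=> j /negbTE jb; rewrite !mxE [(enum_val b).1 == j]eq_sym jb mulr0.
  rewrite !mxE eqxx mulr1 /nbt_kernel /rev_kernel /=.
  move: (enum_val a) (enum_val b) => [i j] [k l] /=; rewrite xpair_eqE (eq_sym j k).
  by case: (k == j); case: (l == i); rewrite /= ?mulr1n ?mulr0n ?subr0 ?subrr ?oppr0 ?add0r.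
(* [N *m N] is diagonal with entries [u e * u (rev e)], so [K] inverts
   [1%:M - N *m N = (1%:M - N) *m (1%:M + N)]. *)
have XN : K *m (1%:M - N) *m (1%:M + N) = 1%:M.
  have -> : K *m (1%:M - N) *m (1%:M + N) = K *m (1%:M - N *m N).
    by rewrite -mulmxA mulmxBl mul1mx (mulmxDr N) mulmx1 opprD addrA addrK.
  rewrite !kernel_mxM kernel_mx1 kernel_mxN kernel_mxD kernel_mxM.
  apply: eq_kernel_mx => e f; rewrite sum_diag_kernel.
  rewrite sum_rev_kernel /= /rev_kernel rev_edgeK /= (eq_sym f e).
  case: (e == f); rewrite ?mulr0n ?mulr0 ?subr0 ?mulr0//.
  by rewrite mulr1n mulVf// u1.
have NX : (1%:M + N) *m (K *m (1%:M - N)) = 1%:M by exact: mulmx1C.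
have -> : 1%:M - kernel_mx (nbt_kernel u)
    = (1%:M + N) *m (1%:M + (K *m (1%:M - N) *m P) *m (- Q)).
  rewrite WE mulmxDr mulmx1 !mulmxA; congr (_ + _).
  by rewrite -[(1%:M + N) *m K *m _]mulmxA NX mul1mx mulmxN.
rewrite det_mulmx det_1D_rev_kernel det_sylvester; congr (_ * \det _).
apply/matrixP => i j; rewrite !mxE.
have KN : K *m (1%:M - N) = kernel_mx (fun e f : E =>
    (d e)^-1 * ((e == f)%:R - rev_kernel predT e f)).
  rewrite kernel_mx1 kernel_mxN kernel_mxD kernel_mxM; apply: eq_kernel_mx => e f.
  by rewrite sum_diag_kernel.
have PE (e : E) k : (K *m (1%:M - N) *m P) (enum_rank e) k
   = (d e)^-1 * (u e *+ (e.2 == k) - u e * u (rev e) *+ (e.1 == k)).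
  rewrite KN mxE.
  transitivity (\sum_(f : E) (d e)^-1 * (1 *+ (e == f) * (u f *+ (f.2 == k)))
                - \sum_(f : E) (d e)^-1 * (rev_kernel predT e f * (u f *+ (f.2 == k)))).
    rewrite -sumrB (reindex enum_rank) /=; last by apply: onW_bij; exact: enum_rank_bij.
    by apply: eq_bigr => f _; rewrite !mxE !enum_rankK; ring.
  rewrite -!mulr_sumr sum_rev_kernel (sum_diag_kernel _ _ (fun f : E => u f *+ (f.2 == k))) /=.
  by rewrite /rev_edge /= mul1r -mulrBr mulrnAr.
rewrite (reindex enum_rank) /=; last by apply: onW_bij; exact: enum_rank_bij.
under eq_bigr => e _ do rewrite PE !mxE enum_rankK.
rewrite [X in _ + X](_ : _ = \sum_k \sum_l - (k == i)%:R * ((d (k, l))^-1 *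
  (u (k, l) *+ (l == j) - u (k, l) * u (l, k) *+ (k == j)))); last first.
  by rewrite pair_bigA; apply: eq_bigr => -[k l].
rewrite (bigD1 i)//= [X in _ + (_ + X)]big1 ?addr0; last first.
  by move=> k /negbTE ki; apply: big1 => l _; rewrite ki oppr0 mul0r.
rewrite eqxx.
have -> : u (i, j) / (1 - u (i, j) * u (j, i))
    = \sum_l (d (i, l))^-1 * (u (i, l) *+ (l == j)).
  rewrite (bigD1 j)//= eqxx mulr1n big1 ?addr0 1?mulrC// => l /negbTE lj.
  by rewrite lj mulr0n mulr0.
rewrite mulrnDl -sumrMnl -addrA -sumrB; congr (_ + _); apply: eq_bigr => l _.
rewrite /d /rev_edge /=; case: (i == j); rewrite ?mulr1n ?mulr0n; ring.
Qed.

End IharaBass.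

(** * The determinant of the non-backtracking matrix *)

Lemma det_mx22 (R : comNzRingType) (A : 'M[R]_2) :
  \det A = A 0 0 * A 1 1 - A 0 1 * A 1 0.
Proof.
rewrite (expand_det_row _ 0) !big_ord_recl big_ord0 /cofactor !det_mx11 !mxE /= addr0.
rewrite expr0 expr1 mul1r mulN1r mulrN; congr (A _ _ * A _ _ - A _ _ * A _ _);
  exact/val_inj.
Qed.

Section ZbpDet.
Variables (R : realType) (n : nat) (M : 'M[R]_n) (v : 'I_n -> R).
Hypothesis Msym : M^T = M.
Hypothesis v_gt0 : forall i, 0 < v i.
Hypothesis vE : forall i, v i = 1 + \sum_j `|M i j| * v j.

Let node i := 1 - \sum_(k in nbrs M i) alpha M k i.
Let excl i j := 1 - alpha_excl M i j.
Let node0 i : node i != 0. Proof. by rewrite gt_eqF// (node_gt0 Msym v_gt0 vE). Qed.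
Let excl0 i j : excl i j != 0. Proof. by rewrite gt_eqF// (alpha_excl_gt0 Msym v_gt0 vE). Qed.
Let exclE i j : excl i j = node i + alpha M j i.
Proof. exact: alpha_excl_node Msym v_gt0 vE i j. Qed.

(** Follows from [excl i j = node i + alpha M j i] and [alpha M j i = M j i * rprime M j i]. It
    turns the edge factors of the Ihara-Bass identity into GaBP quantities. *)
Lemma rprime_rev i j : 1 - rprime M i j * rprime M j i = node i / excl i j.
Proof.
have aE := alpha_rprime Msym v_gt0 vE j i.
apply: (mulIf (excl0 i j)); rewrite divfK// mulrBl mul1r {1}exclE aE.
rewrite (sym_entry Msym) /rprime -/(excl i j) -/(excl j i).
by field; rewrite !excl0.
Qed.

Lemma rprime_rev_neq0 i j : 1 - rprime M i j * rprime M j i != 0.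
Proof. by rewrite rprime_rev mulf_neq0// invr_eq0. Qed.

Lemma Zbp_edgeE i j :
  Zbp_edge M i j / (Zbp_node M i * Zbp_node M j) = 1 - rprime M i j * rprime M j i.
Proof.
rewrite rprime_rev /Zbp_edge /Zbp_node det_mx22 !mxE /= -/(node i) -/(node j).
rewrite -/(excl i j) -/(excl j i).
have aE := alphaE Msym v_gt0 vE i j.
(* Uses [excl j i = node j + alpha M i j] and the fixed-point equation
   [excl i j * alpha M i j = M i j ^+ 2]. *)
have -> : excl i j * excl j i - - M i j * - M i j = excl i j * node j.
  rewrite [excl j i]exclE aE -/(excl i j) mulrDr mulrCA divff// mulr1 expr2.
  by ring.
by field; rewrite !node0 excl0.
Qed.

Lemma ZbpE : Zbp M = (\prod_i node i)^-1 *
  \prod_(e : 'I_n * 'I_n | (e.1 < e.2)%N) (1 - rprime M e.1 e.2 * rprime M e.2 e.1).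
Proof.
rewrite /Zbp prodfV; congr (_ * _).
rewrite -(pair_big_dep predT (fun i j : 'I_n => (i < j)%N)
  (fun i j => 1 - rprime M i j * rprime M j i)) /=.
apply: eq_bigr => i _; rewrite big_mkcondr /=; apply: eq_bigr => j _.
rewrite Zbp_edgeE; case: ifP => // /negbT; rewrite negbK => /eqP m0.
by rewrite /rprime m0 mul0r mul0r subr0.
Qed.

Lemma Zbp_neq0 : Zbp M != 0.
Proof.
rewrite ZbpE mulf_neq0 ?invr_eq0//; apply/prodf_neq0 => // e _.
exact: rprime_rev_neq0.
Qed.

(** For [u = rprime] the vertex matrix of the Ihara-Bass identity is [I - M] with row [i] divided by
    [node i]. These row factors and the edge factors together make up [Zbp M]. *)
Lemma det_nbt_Zbp : (forall i, M i i = 0) ->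
  \det (1%:M - kernel_mx (nbt_kernel (fun e : 'I_n * 'I_n => rprime M e.1 e.2)))
    = Zbp M * \det (1%:M - M).
Proof.
move=> M0.
rewrite det_1B_nbt_kernel; last 2 first.
- by move=> i; rewrite /= /rprime M0 mul0r.
- by move=> [i j]; exact: rprime_rev_neq0.
rewrite ZbpE [_^-1 * _]mulrC -mulrA; congr (_ * _).
have -> : (\prod_i node i)^-1 = \det (diag_mx (\row_i (node i)^-1)).
  by rewrite det_diag -prodfV; apply: eq_bigr => i _; rewrite mxE.
rewrite -det_mulmx; congr (\det _); apply/matrixP => i j.
rewrite mul_diag_mx !mxE /=.
have aE k : rprime M i k * rprime M k i / (1 - rprime M i k * rprime M k i)
    = alpha M k i / node i.
  rewrite rprime_rev (alpha_rprime Msym v_gt0 vE) (sym_entry Msym).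
  rewrite {1}/rprime -/(excl i k).
  by field; rewrite node0 excl0.
under eq_bigr => k _ do rewrite aE.
rewrite -mulr_suml -(sum_nbrs_alpha Msym v_gt0 vE).
have -> : \sum_(k in nbrs M i) alpha M k i = 1 - node i by rewrite /node; ring.
have -> : 1 + (1 - node i) / node i = (node i)^-1 by field; rewrite node0.
rewrite rprime_rev /rprime -/(excl i j) mulrBr mulr_natr; congr (_ - _).
by field; rewrite node0 excl0.
Qed.

(** In the norm weighted by [v], a vector with [w = w M] satisfies
    [sum |w_j| v_j <= sum |w_i| (v_i - 1)], which leaves [sum |w_i| <= 0]. *)
Lemma det_1BM_neq0 : \det (1%:M - M) != 0.
Proof.
apply/negP => /det0P[w w0 wM]; case/negP: w0.
have wE : w = w *m M by apply/eqP; rewrite -subr_eq0 -{1}[w]mulmx1 -mulmxBr wM.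
have le : \sum_j `|w 0 j| * v j <= \sum_i `|w 0 i| * (v i - 1).
  have -> : \sum_i `|w 0 i| * (v i - 1) = \sum_j \sum_i `|w 0 i| * `|M i j| * v j.
    rewrite exchange_big /=; apply: eq_bigr => i _; rewrite {1}vE addrC addKr mulr_sumr.
    by apply: eq_bigr => j _; rewrite mulrA.
  apply: ler_sum => j _; rewrite -mulr_suml ler_wpM2r ?(ltW (v_gt0 j))// {1}wE mxE.
  by apply: (le_trans (ler_norm_sum _ _ _)); apply: ler_sum => i _; rewrite normrM.
have s0 : \sum_j `|w 0 j| = 0.
  apply/eqP; rewrite eq_le sumr_ge0// andbT.
  move: le; under [leRHS]eq_bigr => i _ do rewrite mulrBr mulr1.
  by rewrite sumrB lerBrDl gerDr.
apply/eqP/matrixP => i j; rewrite ord1 [RHS]mxE.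
have z := psumr_eq0P (fun j _ => normr_ge0 (w 0 j)) s0.
by have /eqP := z j isT; rewrite normr_eq0 => /eqP.
Qed.

Let r_abs (e : 'I_n * 'I_n) : R := `|rprime M e.1 e.2|.

(** The row vector [h] of cavity values satisfies [h W = h - 1 <= (1 - 1/C) h] because [h <= C].
    Iterating, and keeping one term of entry [a] of [h W^k], bounds each diagonal entry of [W^k] by
    [q^k]. *)
Lemma trace_nbt_abs_bound : exists2 q : R, 0 <= q < 1 &
  forall k, \tr (kernel_mx (nbt_kernel r_abs) ^+ k) <= #|{: 'I_n * 'I_n}|%:R * q ^+ k.
Proof.
pose h := cavity M v.
have h1 e : 1 <= h e := cavity_ge1 Msym v_gt0 vE e.
have h0 e : 0 < h e by exact: lt_le_trans (h1 e).
(* The summand 1 ensures [C >= 1], hence [q >= 0], even for [n = 0]. *)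
pose C := 1 + \sum_e h e.
have hC e : h e <= C.
  rewrite /C (bigD1 e)//= addrCA lerDl addr_ge0// sumr_ge0// => f _; exact: ltW.
have C1 : 1 <= C by rewrite lerDl sumr_ge0// => f _; exact: ltW.
have C0 : 0 < C by exact: lt_le_trans C1.
pose q := 1 - C^-1.
have q0 : 0 <= q by rewrite subr_ge0 invf_le1.
exists q; first by rewrite q0 gtrBl invr_gt0.
move=> k; set W := kernel_mx _.
have W0 a b : 0 <= W a b by rewrite mxE /nbt_kernel; case: ifP => // _; exact: normr_ge0.
have Wk0 l a b : 0 <= (W ^+ l) a b.
  elim: l a b => [|l IH] a b; first by rewrite mxE ler0n.
  by rewrite exprS mxE sumr_ge0// => c _; rewrite mulr_ge0.
pose H : 'rV[R]_#|{: 'I_n * 'I_n}| := \row_a h (enum_val a).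
have HW b : (H *m W) 0 b <= q * H 0 b.
  have -> : (H *m W) 0 b = h (enum_val b) - 1.
    rewrite mxE; under eq_bigr => a _ do rewrite !mxE.
    rewrite (sum_enum_val (fun e => h e * nbt_kernel r_abs e (enum_val b))).
    case: (enum_val b) => j i.
    rewrite /h (cavityE Msym v_gt0 vE) addrAC subrr add0r.
    rewrite -(pair_bigA _ (fun k l => cavity M v (k, l) * nbt_kernel r_abs (k, l) (j, i))) /=.
    rewrite [RHS]big_mkcond; apply: eq_bigr => l _.
    rewrite (bigD1 j)//= big1 ?addr0; last first.
      by move=> j' /negbTE jj; rewrite /nbt_kernel /= eq_sym jj mulr0.
    by rewrite /nbt_kernel /= eqxx eq_sym /=; case: eqP; rewrite ?mulr0// mulrC.
  rewrite [H 0 b]mxE /q mulrBl mul1r lerD2l lerN2 mulrC ler_pdivrMr// mul1r.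
  exact: hC.
have HWk b : (H *m W ^+ k) 0 b <= q ^+ k * H 0 b.
  elim: k b => [|l IH] b; first by rewrite !expr0 mulmx1 mul1r.
  rewrite exprSr -mulmxE mulmxA mxE.
  apply: (@le_trans _ _ (\sum_a q ^+ l * H 0 a * W a b)).
    by apply: ler_sum => a _; rewrite ler_wpM2r.
  under eq_bigr => a _ do rewrite -mulrA.
  rewrite -mulr_sumr exprSr -mulrA ler_wpM2l ?exprn_ge0//.
  by have := HW b; rewrite mxE.
have diag a : (W ^+ k) a a <= q ^+ k.
  have Ha : 0 < H 0 a by rewrite mxE.
  rewrite -(ler_pM2r Ha) mulrC; apply: le_trans (HWk a).
  rewrite [leRHS]mxE (bigD1 a)//= lerDl sumr_ge0// => b _.
  by rewrite mulr_ge0// mxE ltW.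
rewrite mulr_natl -[in leRHS](card_ord #|_|) -sumr_const.
by apply: ler_sum => a _.
Qed.

End ZbpDet.

(** * Products over orbits *)

Section Orbits.
Variables (R : realType) (n : nat) (M : 'M[R]_n).
Let r (e : 'I_n * 'I_n) : R := rprime M e.1 e.2.

Lemma prod_exp_count (T : finType) (P : pred T) (F : T -> R) (s : seq T) :
  \prod_(x | P x) F x ^+ count_mem x s = \prod_(x <- s | P x) F x.
Proof.
elim: s => [|y s IH]; first by rewrite big_nil big1// => x _; rewrite expr0.
rewrite big_cons -IH; under eq_bigr => x _ do rewrite /= exprD.
rewrite big_split /=.
have -> : \prod_(x | P x) F x ^+ (y == x) = if P y then F y else 1.
  case: ifP => Py.
    rewrite (bigD1 y)//= eqxx expr1 big1 ?mulr1// => x /andP[_ /negbTE xy].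
    by rewrite eq_sym xy.
  by rewrite big1// => x Px; case: eqP => // yx; rewrite yx Px in Py.
by case: ifP; rewrite ?mul1r.
Qed.

Lemma closed_walk_rot k s : closed_walk M (rot k s) = closed_walk M s.
Proof.
rewrite /closed_walk size_rot steps_rot; congr (_ && _).
by apply: perm_all; rewrite perm_rot.
Qed.

Lemma prod_nstep s : closed_walk M s ->
  \prod_i \prod_(j | adj M i j) rprime M i j ^+ nstep s i j = walk_weight r s.
Proof.
move=> /andP[_ /allP adjs].
rewrite (pair_big_dep xpredT (fun i j => adj M i j)
  (fun i j => rprime M i j ^+ nstep s i j)) /=.
transitivity (\prod_(e | adj M e.1 e.2) r e ^+ count_mem e (steps s)).
  by apply: eq_bigr => -[i j].
rewrite prod_exp_count /walk_weight big_seq_cond [RHS]big_seq.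
by apply: eq_bigl => e; rewrite andb_idr// => /adjs.
Qed.

Lemma walk_weight_open s : (0 < size s)%N -> ~~ closed_walk M s -> walk_weight r s = 0.
Proof.
move=> s0; rewrite /closed_walk s0 /= => /allPn[e es]; rewrite negbK => /eqP e0.
by rewrite /walk_weight (big_rem e)//= /r /rprime e0 mul0r mul0r.
Qed.

Variable L : nat.
Hypothesis L0 : (0 < L)%N.

(** The representative chosen by [pick] is a rotation of [t], and the weight is invariant under
    rotation. *)
Lemma orbit_weightE (t : L.-tuple 'I_n) : closed_walk M t ->
  orbit_weight M (orbit_of t) = walk_weight r t.
Proof.
move=> ct; rewrite /orbit_weight; case: pickP => [t'|/(_ t)]; last by rewrite orbit_of_refl.
move=> /orbit_ofP[k _ t'k].
by rewrite prod_nstep t'k ?closed_walk_rot// walk_weight_rot.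
Qed.

Lemma sum_bl_orbits (f : R -> R) :
  \sum_(g in bl_orbits M L) f (orbit_weight M g) *+ L
    = \sum_(t : L.-tuple 'I_n | [&& closed_walk M t, period t == L & backtrackless t])
        f (walk_weight r t).
Proof.
have pE (t : L.-tuple 'I_n) : `[< primitive t >] = (period t == L).
  have t0 : (0 < size t)%N by rewrite size_tuple.
  have h := primitive_period t0; rewrite size_tuple in h.
  by apply/asboolP/eqP; rewrite h.
rewrite /bl_orbits; set A := finset _.
have inA t : (t \in A) = [&& closed_walk M t, period t == L & backtrackless t].
  by rewrite inE pE.
rewrite -(@sum_orbit_of n L _ A (fun t => f (walk_weight r t))) //.
- by apply: eq_bigl => t; rewrite inA.
- by move=> t; rewrite inA => /and3P[_ /eqP].
- move=> t t'; rewrite !inA => tA /orbit_ofP[k _ ->].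
  by rewrite closed_walk_rot period_rot backtrackless_rot.
- by move=> t; rewrite inA => /and3P[ct _ _]; rewrite orbit_weightE.
Qed.

(** Tuples that are not walks of the graph have weight 0, and [m > 0] makes their powers vanish
    too. *)
Lemma sum_orbit_weight_exp m : (0 < m)%N ->
  \sum_(t : L.-tuple 'I_n | (period t == L) && backtrackless t) walk_weight r t ^+ m
    = \sum_(g in bl_orbits M L) orbit_weight M g ^+ m *+ L.
Proof.
move=> m0; rewrite (sum_bl_orbits (fun x => x ^+ m)).
rewrite big_mkcond [RHS]big_mkcond; apply: eq_bigr => t _.
case: (boolP (closed_walk M t)) => //= ct.
by rewrite walk_weight_open ?size_tuple// expr0n (gtn_eqF m0) /= if_same.
Qed.

(** An orbit has [L >= 1] representatives, all among the tuples counted by the trace, and the other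
    tuples contribute nonnegative terms. *)
Lemma sum_norm_orbit_weight :
  \sum_(g in bl_orbits M L) `|orbit_weight M g|
    <= \tr (kernel_mx (nbt_kernel (fun e => `|r e|)) ^+ L).
Proof.
apply: (@le_trans _ _ (\sum_(g in bl_orbits M L) `|orbit_weight M g| *+ L)).
  by apply: ler_sum => g _; rewrite -mulr_natr ler_peMr// ler1n.
rewrite sum_bl_orbits trace_nbt// big_mkcond [leRHS]big_mkcond.
apply: ler_sum => t _; rewrite /walk_weight normr_prod.
case: (backtrackless t); rewrite ?andbF ?andbT//.
by case: ifP => // _; rewrite prodr_ge0.
Qed.

End Orbits.

(** * The orbit product as a polynomial in a length variable *)

Section OrbitPoly.
Variables (R : realType) (n : nat) (M : 'M[R]_n).
Let r (e : 'I_n * 'I_n) : R := rprime M e.1 e.2.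
Let W := kernel_mx (nbt_kernel r).

Definition orbit_poly N : {poly R} :=
  \prod_(1 <= L < N.+1) \prod_(g in bl_orbits M L) (1 - orbit_weight M g *: 'X^L).

Lemma orbit_partial_prodE N : orbit_partial_prod M N = ((orbit_poly N).[1])^-1.
Proof.
rewrite /orbit_partial_prod /orbit_poly horner_prod -prodfV.
apply: eq_bigr => L _; rewrite horner_prod -prodfV; apply: eq_bigr => g _.
by rewrite !hornerE expr1n mulr1.
Qed.

(** Both polynomials have constant coefficient 1. In degree [j] the logarithmic derivatives agree:
    [tr W^j] is the sum over [L] dividing [j] of [L w(g)^(j / L)], over the orbits [g] of length
    [L]. *)
Lemma orbit_poly_coef N k : (k <= N)%N ->
  (orbit_poly N)`_k = (\det (1%:M - 'X *: map_mx polyC W))`_k.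
Proof.
pose t (L : nat) (g : {set L.-tuple 'I_n}) : {poly R} :=
  \sum_(1 <= m < N.+1) L%:R *: (orbit_weight M g *: 'X^L) ^+ m.
pose T := \sum_(1 <= L < N.+1) \sum_(g in bl_orbits M L) t L g.
have ldP : logder N (orbit_poly N) T.
  rewrite /orbit_poly /T big_seq_cond [X in logder _ _ X]big_seq_cond.
  apply: logder_prod => L; rewrite mem_index_iota andbT => /andP[L0 _].
  by apply: logder_prod => g _; exact: logder_1subcX.
(* The series of an orbit of length [L] meets [X^j] only at [m = j / L]. *)
have tE (L : nat) (g : {set L.-tuple 'I_n}) j : (0 < L)%N -> (j <= N)%N -> (0 < j)%N ->
    (t L g)`_j = if (L %| j)%N then orbit_weight M g ^+ (j %/ L) *+ L else 0.
  move=> L0 jN j0; rewrite /t coef_sum.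
  under eq_bigr => m _ do rewrite exprZn -exprM !coefZ coefXn.
  case: ifP => Lj.
    rewrite (bigD1_seq (j %/ L)%N) ?iota_uniq//=; last first.
      by rewrite mem_index_iota divn_gt0// dvdn_leq//= ltnS (leq_trans (leq_div _ _)).
    rewrite mulnC divnK// eqxx mulr1 mulr_natl big1 ?addr0// => m mj.
    case: eqP => [jm|]; last by rewrite !mulr0.
    by rewrite jm mulKn// eqxx in mj.
  rewrite big1// => m _; case: eqP => [jm|]; last by rewrite !mulr0.
  by rewrite jm dvdn_mulr in Lj.
have T0 : T`_0 = 0.
  rewrite /T coef_sum big_seq_cond big1// => L; rewrite mem_index_iota andbT => /andP[L0 _].
  rewrite coef_sum big1// => g _; rewrite coef_sum big_seq_cond big1// => m.
  rewrite mem_index_iota andbT => /andP[m0 _].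
  rewrite exprZn -exprM !coefZ coefXn; case: eqP => [/esym/eqP|]; last by rewrite !mulr0.
  by rewrite muln_eq0 !gtn_eqF.
move=> kN; apply: (logder_uniq ldP (logder_det N W)) => //.
  rewrite -!horner_coef0 /orbit_poly horner_prod.
  rewrite big_seq_cond big1; last first.
    move=> L; rewrite mem_index_iota andbT => /andP[L0 _].
    rewrite horner_prod big1// => g _.
    by rewrite !hornerE expr0n gtn_eqF// mulr0 subr0.
  rewrite -[RHS]/(horner_eval 0 _) -det_map_mx.
  rewrite (_ : map_mx _ _ = 1%:M) ?det1//.
  apply/matrixP => i j; rewrite !mxE /= /horner_eval !hornerE.
  by rewrite subr0 hornerMn hornerC.
move=> [_|j jN].
  rewrite T0 coef_sum big_seq_cond big1// => j; rewrite mem_index_iota andbT => /andP[j0 _].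
  by rewrite coefZ coefXn eq_sym gtn_eqF// mulr0.
rewrite [RHS]coef_sum (bigD1_seq j.+1) ?iota_uniq ?mem_index_iota//=.
rewrite coefZ coefXn eqxx mulr1 big1 ?addr0; last first.
  by move=> i /negbTE ij; rewrite coefZ coefXn eq_sym ij mulr0.
rewrite trace_nbt// (sum_walk_weight_primitive _ (N := N))// /T coef_sum.
rewrite [RHS]big_mkcond big_seq_cond [RHS]big_seq_cond; apply: eq_bigr => L.
rewrite mem_index_iota andbT => /andP[L0 _].
rewrite coef_sum; under eq_bigr => g _ do rewrite tE//.
case: ifP => Lj; last by rewrite big1.
by rewrite sum_orbit_weight_exp// divn_gt0// dvdn_leq.
Qed.

End OrbitPoly.

(** * Coefficientwise majorants and their tails *)

Section Majorant.
Variable R : realType.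
Implicit Types p q : {poly R}.

Definition majorized p q := forall k, `|p`_k| <= q`_k.

Lemma majorizedM p1 q1 p2 q2 :
  majorized p1 q1 -> majorized p2 q2 -> majorized (p1 * p2) (q1 * q2).
Proof.
move=> h1 h2 k; rewrite !coefM; apply: (le_trans (ler_norm_sum _ _ _)).
by apply: ler_sum => i _; rewrite normrM ler_pM.
Qed.

Lemma majorized_prod (I : Type) (s : seq I) (P : pred I) (p q : I -> {poly R}) :
  (forall i, P i -> majorized (p i) (q i)) ->
  majorized (\prod_(i <- s | P i) p i) (\prod_(i <- s | P i) q i).
Proof.
move=> pq; apply: (big_ind2 majorized) => //.
  by move=> k; rewrite coef1; case: eqP; rewrite ?normr1 ?normr0.
by move=> *; exact: majorizedM.
Qed.

(** Beyond degree [N] a coefficient of [q] is at most [q_k x^k / x^(N+1)], since [x > 1]. *)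
Lemma majorized_tail p q N (x : R) : 1 < x -> majorized p q ->
  `|p.[1] - \sum_(k < N.+1) p`_k| <= q.[x] / x ^+ N.+1.
Proof.
move=> x1 pq; have x0 : 0 < x by exact: lt_trans x1.
set m := maxn (maxn (size p) (size q)) N.+1.
have Nm : (N.+1 <= m)%N by exact: leq_maxr.
have pE : p.[1] = \sum_(0 <= k < m) p`_k.
  rewrite big_mkord (@horner_coef_wide _ m); last first.
    by rewrite (leq_trans _ (leq_maxl _ _))// leq_maxl.
  by apply: eq_bigr => k _; rewrite expr1n mulr1.
have qE : q.[x] = \sum_(0 <= k < m) q`_k * x ^+ k.
  rewrite big_mkord (@horner_coef_wide _ m)//.
  by rewrite (leq_trans _ (leq_maxl _ _))// leq_maxr.
rewrite pE qE -(big_mkord predT (fun k => p`_k)) (@big_cat_nat _ _ _ N.+1 0%N m)//=.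
rewrite addrAC subrr add0r ler_pdivlMr ?exprn_gt0//.
have q0 k : 0 <= q`_k := le_trans (normr_ge0 _) (pq k).
apply: (@le_trans _ _ (\sum_(N.+1 <= k < m) q`_k * x ^+ k)); last first.
  rewrite [leRHS](@big_cat_nat _ _ _ N.+1 0%N m)//= lerDr sumr_ge0// => k _.
  by rewrite mulr_ge0// exprn_ge0// ltW.
apply: (@le_trans _ _ ((\sum_(N.+1 <= k < m) q`_k) * x ^+ N.+1)).
  rewrite ler_wpM2r ?exprn_ge0 ?(ltW x0)//; apply: (le_trans (ler_norm_sum _ _ _)).
  exact: ler_sum.
rewrite mulr_suml big_nat_cond [leRHS]big_nat_cond; apply: ler_sum => k /andP[/andP[Nk _] _].
by rewrite ler_wpM2l// ler_weXn2l// ltW.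
Qed.

End Majorant.

(** * Convergence of the orbit product *)

Section OrbitLimit.
Variables (R : realType) (n : nat) (M : 'M[R]_n) (q : R).
Let r (e : 'I_n * 'I_n) : R := rprime M e.1 e.2.
Let W := kernel_mx (nbt_kernel r).
Let E := #|{: 'I_n * 'I_n}|.
Hypothesis q01 : 0 <= q < 1.
Hypothesis trW : forall k,
  \tr (kernel_mx (nbt_kernel (fun e => `|r e|)) ^+ k) <= E%:R * q ^+ k.

Definition orbit_majorant N : {poly R} :=
  \prod_(1 <= L < N.+1) \prod_(g in bl_orbits M L) (1 + `|orbit_weight M g| *: 'X^L).

Lemma orbit_poly_majorized N : majorized (orbit_poly M N) (orbit_majorant N).
Proof.
rewrite /orbit_poly /orbit_majorant big_seq_cond [X in majorized _ X]big_seq_cond.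
apply: majorized_prod => L; rewrite mem_index_iota andbT => /andP[L0 _].
apply: majorized_prod => g _ k.
rewrite coefB coefD coef1 !coefZ coefXn.
case: (eqVneq k 0%N) => [->|k0]; case: eqP => kL; rewrite ?mulr0 ?mulr1 ?subr0 ?addr0 ?normr1//.
- by rewrite -kL in L0.
- by rewrite sub0r add0r normrN.
- by rewrite normr0.
Qed.

(** By [1 + y <= exp y] the product is at most the exponential of a sum of traces, which a geometric
    series of ratio [q x] dominates. The bound is uniform in [N]. *)
Lemma orbit_majorant_bound N x : 0 <= x -> q * x < 1 ->
  (orbit_majorant N).[x] <= expR (E%:R / (1 - q * x)).
Proof.
move=> x0 qx1; have /andP[q0 _] := q01.
have qx0 : 0 <= q * x by rewrite mulr_ge0.
apply: (@le_trans _ _ (\prod_(1 <= L < N.+1) expR (E%:R * (q * x) ^+ L))).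
  rewrite /orbit_majorant horner_prod big_seq_cond [leRHS]big_seq_cond.
  apply: ler_prod => L; rewrite mem_index_iota andbT => /andP[L0 _].
  have wE g : (1 + `|orbit_weight M g| *: 'X^L).[x] = 1 + `|orbit_weight M (L := L) g| * x ^+ L.
    by rewrite !hornerE.
  have w0 (g : {set L.-tuple 'I_n}) : 0 <= 1 + `|orbit_weight M g| * x ^+ L.
    by rewrite addr_ge0// mulr_ge0// exprn_ge0.
  rewrite horner_prod; under eq_bigr => g _ do rewrite wE.
  rewrite prodr_ge0//=.
  apply: (@le_trans _ _ (\prod_(g in bl_orbits M L) expR (`|orbit_weight M g| * x ^+ L))).
    by apply: ler_prod => g _; rewrite w0 expR_ge1Dx.
  rewrite -expR_sum ler_expR -mulr_suml exprMn mulrA ler_wpM2r ?exprn_ge0//.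
  exact: le_trans (sum_norm_orbit_weight M L0) (trW L).
rewrite -expR_sum ler_expR -mulr_sumr ler_wpM2l//.
have d0 : 0 < 1 - q * x by rewrite subr_gt0.
rewrite -[leRHS]mul1r ler_pdivlMr//.
have -> : (\sum_(1 <= L < N.+1) (q * x) ^+ L) * (1 - q * x) = q * x - (q * x) ^+ N.+1.
  elim: N => [|N IH]; first by rewrite big_geq// mul0r expr1 subrr.
  by rewrite big_nat_recr//= mulrDl IH [(q * x) ^+ N.+2]exprS; ring.
by have := exprn_ge0 N.+1 qx0; lra.
Qed.

(** Once [N] reaches the size of [D], the value [D.[1]] is the sum of the coefficients of
    [orbit_poly M N] up to degree [N], so the error is the tail of that polynomial. *)
Lemma orbit_poly_cvg :
  (fun N => (orbit_poly M N).[1]) @ \oo --> \det (1%:M - W).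
Proof.
have /andP[q0 q1] := q01.
(* Any [x > 1] with [q x < 1] would do; this one qualifies because [2 q < 1 + q < 2]. *)
pose x := 2 / (1 + q); have q1_gt0 : 0 < 1 + q by lra.
have x1 : 1 < x by rewrite ltr_pdivlMr//; lra.
have qx : q * x < 1 by rewrite mulrA ltr_pdivrMr//; lra.
pose B := expR (E%:R / (1 - q * x)).
(* Evaluating the majorants at [x > 1] makes the tails geometrically small. *)
pose D := \det (1%:M - 'X *: map_mx polyC W).
have D1 : D.[1] = \det (1%:M - W).
  rewrite -[LHS]/(horner_eval 1 _) -det_map_mx; congr (\det _).
  apply/matrixP => i j; rewrite !mxE /= /horner_eval !hornerE.
  by rewrite hornerMn hornerC.
have le N : (size D <= N)%N -> `|(orbit_poly M N).[1] - D.[1]| <= B * x^-1 ^+ N.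
  move=> sN.
  have -> : D.[1] = \sum_(k < N.+1) (orbit_poly M N)`_k.
    rewrite (@horner_coef_wide _ N.+1); last exact: leqW.
    by apply: eq_bigr => k _; rewrite expr1n mulr1 orbit_poly_coef// -ltnS.
  apply: le_trans (majorized_tail N x1 (@orbit_poly_majorized N)) _.
  have x0 : 0 < x by exact: lt_trans x1.
  rewrite exprVn; apply: (@le_trans _ _ (B / x ^+ N.+1)).
    rewrite ler_wpM2r ?invr_ge0 ?exprn_ge0 ?(ltW x0)//.
    by apply: orbit_majorant_bound => //; exact: ltW.
  rewrite ler_wpM2l ?expR_ge0// lef_pV2 ?posrE ?exprn_gt0//.
  by rewrite ler_weXn2l// ltW.
have g : (fun N => B * x^-1 ^+ N) @ \oo --> (0 : R).
  rewrite -(mulr0 B); apply: cvgM; first exact: cvg_cst.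
  apply: cvg_expr; rewrite normfV gtr0_norm ?invf_lt1//; exact: lt_trans x1.
rewrite -D1; apply/cvgrPdist_le => e e0; near=> N.
rewrite distrC; apply: (@le_trans _ _ (B * x^-1 ^+ N)).
  by apply: le; near: N; exact: nbhs_infty_ge.
apply: le_trans (ler_norm _) _; rewrite -normrN -[X in `|X|]add0r.
by near: N; move/cvgrPdist_le: g; apply.
Unshelve. all: by end_near. Qed.

End OrbitLimit.

Theorem theorem4 (R : realType) (n : nat) (M : 'M[R]_n)
    (Msym : M^T = M) (Mdiag : forall i, M i i = 0)
    (Mrho : spectral_radius (absmx M) < 1) :
  (fun N => Zbp M * orbit_partial_prod M N) @ \oo --> (\det (1%:M - M))^-1.
Proof.
have [|i j|v [v0 vE]] := neumann_vector _ Mrho.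
- by apply/matrixP => i j; rewrite !mxE (sym_entry Msym).
- by rewrite mxE.
have {}vE i : v i = 1 + \sum_j `|M i j| * v j.
  by rewrite {1}vE; congr (_ + _); apply: eq_bigr => j _; rewrite mxE.
have [q q01 trW] := trace_nbt_abs_bound Msym v0 vE.
have detW := det_nbt_Zbp Msym v0 vE Mdiag.
have Z0 := Zbp_neq0 Msym v0 vE.
have d0 := det_1BM_neq0 v0 vE.
have -> : (\det (1%:M - M))^-1 = Zbp M * (Zbp M * \det (1%:M - M))^-1.
  by rewrite invfM mulrA divff// mul1r.
apply: cvgM; first exact: cvg_cst.
rewrite -detW.
under eq_cvg do rewrite orbit_partial_prodE.
apply: cvgV; first by rewrite detW mulf_neq0.
exact: orbit_poly_cvg q01 trW.
Qed.
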